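(* Let $$x \frac{\partial Y}{\partial x} = A(x,y) Y,\qquad y \frac{\partial Y}{\partial y} = B(x,y) Y$$ be a completely integrable Pfaffian system with normal crossings in two variables, of dimension $n$, with $A(x,y)=x^{-p}(A_0(y)+A_1(y)x+\dots)$ and $B(x,y)=y^{-q}(B_0(x)+B_1(x)y+\dots)$. Suppose that $A_0(y)$ has rank $r$ and that $m(A)>1$. Then a necessary and sufficient condition for $A$ to be Moser-reducible, i.e. for the existence of $T(x,y)\in GL_n(K)$ such that the leading coefficient satisfies $\operatorname{rank}(\tilde A_0)<r$, where $T[A]=x^{-p}(\tilde A_0+\tilde A_1x+\dots)$, is that the polynomial $$\theta(\lambda):=x^{r}\det\Big(\lambda I+\frac{A_0}{x}+A_1\Big)\Big|_{x=0}$$ vanishes identically in $\lambda$. Moreover, $T(x,y)$ can always be chosen to be compatible with the subsystem $y\,\partial Y/\partial y=BY$. More precisely, it can be chosen as a product of transformations in $GL_n(\mathbb{C}[[y]])$ and polynomial transformations of the form $\mathrm{diag}(x^{\alpha_1},\dots,x^{\alpha_n})$, where $\alpha_1,\dots,\alpha_n$ are nonnegative integers.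
   Context: $K$ is the field of fractions of $\mathbb{C}[[x,y]]$, viewed inside $\mathbb{C}((y))((x))$. A completely integrable Pfaffian system with normal crossings in two variables is a system $x\,\partial Y/\partial x = AY$, $y\,\partial Y/\partial y = BY$, with $Y$ an unknown $n$-dimensional column vector, $p,q$ nonnegative integers, $x^pA$ and $y^qB$ matrices in $\mathbb{C}[[x,y]]^{n\times n}$ with nonzero leading coefficients $A_0(y)=(x^pA)|_{x=0}$ and $B_0(x)=(y^qB)|_{y=0}$, satisfying the integrability condition $x\frac{\partial B}{\partial x}+BA = y\frac{\partial A}{\partial y}+AB$. The pair $(p,q)$ is the Poincaré rank. For $T\in GL_n(K)$, the change of basis $Y=TZ$ replaces $A,B$ by $T[A]=T^{-1}(AT-x\,\partial T/\partial x)$ and $T[B]=T^{-1}(BT-y\,\partial T/\partial y)$. For a matrix $C=x^{-p}(C_0(y)+C_1(y)x+\dots)$, where $p$ is the smallest nonnegative integer for which $x^pC$ has no pole in $x$, the Moser rank is $m(C)=\max(0,\,p+\operatorname{rank}(C_0)/n)$, and the Moser invariant of $A$ is $\mu(A)=\min\{m(T[A]) : T\in GL_n(K)\}$. The matrix $A$ (or the subsystem $x\,\partial Y/\partial x=AY$) is Moser-reducible if $m(A)>\mu(A)$, and Moser-irreducible otherwise. Ranks of matrices depending on $y$ are taken over the field of fractions of $\mathbb{C}[[y]]$. $T$ is compatible with the system if the normal crossings are preserved and the Poincaré rank of the individual subsystems is not elevated; in particular, compatibility with the subsystem $y\,\partial Y/\partial y=BY$ means that $y^{q}\,T[B]$ has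 entries in $\mathbb{C}[[x,y]]$. *)

(* Defs.v *)
From HB Require Import structures.
From mathcomp Require Import all_boot all_order all_algebra zify ring.
From mathcomp Require Import generic_quotient fraction complex.
From mathcomp Require Import boolp classical_sets reals.

Set Implicit Arguments.
Unset Strict Implicit.
Unset Printing Implicit Defensive.

Import Order.TTheory GRing.Theory Num.Theory.
Local Open Scope ring_scope.

Record fps (R : Type) := Fps { fps_coef :> nat -> R }.

Notation "{ 'fps' R }" := (fps R) (at level 0, format "{ 'fps'  R }") : type_scope.

Lemma fpsP (R : Type) (f g : {fps R}) : (forall i, f i = g i) <-> f = g.
Proof.
split=> [|-> //]; case: f g => f [g] /= fg.
by congr Fps; apply/funext.
Qed.

HB.instance Definition _ (R : Type) := gen_eqMixin {fps R}.
HB.instance Definition _ (R : Type) := gen_choiceMixin {fps R}.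

Section FpsRing.
Variable R : comNzRingType.
Implicit Types f g h : {fps R}.

Definition fps_zero : {fps R} := Fps (fun=> 0).
Definition fps_opp f : {fps R} := Fps (fun i => - f i).
Definition fps_add f g : {fps R} := Fps (fun i => f i + g i).

Fact fps_addA : associative fps_add.
Proof. by move=> f g h; apply/fpsP => i /=; rewrite addrA. Qed.
Fact fps_addC : commutative fps_add.
Proof. by move=> f g; apply/fpsP => i /=; rewrite addrC. Qed.
Fact fps_add0 : left_id fps_zero fps_add.
Proof. by move=> f; apply/fpsP => i /=; rewrite add0r. Qed.
Fact fps_addN : left_inverse fps_zero fps_opp fps_add.
Proof. by move=> f; apply/fpsP => i /=; rewrite addNr. Qed.

HB.instance Definition _ :=
  GRing.isZmodule.Build {fps R} fps_addA fps_addC fps_add0 fps_addN.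

Definition fpsC (c : R) : {fps R} := Fps (fun i => if i == 0%N then c else 0).
Definition fpsX : {fps R} := Fps (fun i => (i == 1%N)%:R).
Definition fps_mul f g : {fps R} :=
  Fps (fun n => \sum_(i < n.+1) f i * g (n - i)%N).

Definition fps_trunc n f : {poly R} := \poly_(i < n) f i.

Lemma coef_fps_trunc n f i : (i < n)%N -> (fps_trunc n f)`_i = f i.
Proof. by move=> lt_in; rewrite coef_poly lt_in. Qed.

Lemma fps_mul_trunc n i f g (lt_in : (i < n)%N) :
  fps_mul f g i = (fps_trunc n f * fps_trunc n g)`_i.
Proof.
rewrite coefM; apply: eq_bigr => j _.
rewrite !coef_fps_trunc //; first by apply: leq_ltn_trans lt_in; rewrite leq_subr.
by apply: leq_ltn_trans lt_in; rewrite -ltnS.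
Qed.

Fact fps_mulA : associative fps_mul.
Proof.
move=> f g h; apply/fpsP => n.
transitivity ((fps_trunc n.+1 f * (fps_trunc n.+1 g * fps_trunc n.+1 h))`_n).
  rewrite coefM /=; apply: eq_bigr => i _; rewrite coef_fps_trunc //.
  by congr (_ * _); apply: fps_mul_trunc; rewrite ltnS leq_subr.
rewrite mulrA coefM; apply: eq_bigr => i _.
rewrite [(fps_trunc _ h)`__]coef_fps_trunc ?ltnS ?leq_subr //.
by congr (_ * _); rewrite -fps_mul_trunc.
Qed.

Fact fps_mulC : commutative fps_mul.
Proof.
by move=> f g; apply/fpsP => n; rewrite !(@fps_mul_trunc n.+1) // mulrC.
Qed.

Fact fps_mul1 : left_id (fpsC 1) fps_mul.
Proof.
move=> f; apply/fpsP => n /=.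
rewrite big_ord_recl /= mul1r subn0 big1 ?addr0 // => i _.
by rewrite mul0r.
Qed.

Fact fps_mulDl : left_distributive fps_mul +%R.
Proof.
move=> f g h; apply/fpsP => n /=; rewrite -big_split /=.
by apply: eq_bigr => i _; rewrite mulrDl.
Qed.

Fact fps_one_neq0 : fpsC 1 != 0.
Proof.
by apply/eqP => /fpsP /(_ 0%N) /= /eqP; rewrite oner_eq0.
Qed.

HB.instance Definition _ := GRing.Zmodule_isComNzRing.Build {fps R}
  fps_mulA fps_mulC fps_mul1 fps_mulDl fps_one_neq0.

Lemma fpsME f g n : (f * g) n = \sum_(i < n.+1) f i * g (n - i)%N.
Proof. by []. Qed.

Definition fps_deriv f : {fps R} := Fps (fun i => f i.+1 *+ i.+1).

End FpsRing.

Arguments fpsX {R}.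

Section FpsUnit.
Variable R : comUnitRingType.
Implicit Types f g : {fps R}.

Fixpoint fps_inv_seq f n : seq R :=
  if n is m.+1 then
    let s := fps_inv_seq f m in
    rcons s ((f 0%N)^-1 *
      ((m == 0%N)%:R - \sum_(i < m) f (m - i)%N * s`_i))
  else [::].

Definition fps_unit : pred {fps R} := fun f => f 0%N \is a GRing.unit.
Definition fps_inv f : {fps R} :=
  if fps_unit f then Fps (fun n => (fps_inv_seq f n.+1)`_n) else f.

Lemma size_fps_inv_seq f n : size (fps_inv_seq f n) = n.
Proof. by elim: n => //= n IHn; rewrite size_rcons IHn. Qed.

Lemma nth_fps_inv_seq f n i : (i < n)%N ->
  (fps_inv_seq f n)`_i = (fps_inv_seq f i.+1)`_i.
Proof.
elim: n => // n IHn; rewrite ltnS leq_eqVlt => /predU1P[-> //|lt_in].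
by rewrite [in LHS]/= nth_rcons size_fps_inv_seq lt_in IHn.
Qed.

Fact fps_mulVr : {in fps_unit, left_inverse 1 fps_inv *%R}.
Proof.
move=> f Uf; rewrite /fps_inv; have uf : fps_unit f := Uf; rewrite uf.
apply/fpsP => n; rewrite fpsME big_ord_recr /= subnn.
rewrite nth_rcons size_fps_inv_seq ltnn eqxx mulrC.
rewrite mulrA mulrV // mul1r.
set S := (X in X + _ = _); set S' := (X in _ + (_ - X) = _).
have -> : S = S'.
  apply: eq_bigr => i _; rewrite mulrC; congr (_ * _).
  by rewrite [RHS]nth_fps_inv_seq.
by rewrite addrC subrK; case: n {S S'}.
Qed.

Fact fps_unitPl f g : g * f = 1 -> fps_unit f.
Proof.
move=> /fpsP /(_ 0%N); rewrite fpsME big_ord1 /= => gf1.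
by apply/unitrPr; exists (g 0%N); rewrite mulrC.
Qed.

Fact fps_inv_out : {in [predC fps_unit], fps_inv =1 id}.
Proof. by move=> f; rewrite inE /fps_inv => /negPf Uf; rewrite ifF. Qed.

HB.instance Definition _ := GRing.ComNzRing_hasMulInverse.Build {fps R}
  fps_mulVr fps_unitPl fps_inv_out.

Lemma fps_unitE f : (f \is a GRing.unit) = (f 0%N \is a GRing.unit).
Proof. by []. Qed.

End FpsUnit.

Section FpsDomain.
Variable R : idomainType.
Implicit Types f g : {fps R}.

Lemma fps_neq0P f : f != 0 ->
  exists2 m, f m != 0 & forall i, (i < m)%N -> f i = 0.
Proof.
move=> f0; have exf : exists m, f m != 0.
  apply/not_existsP => f_all0; case/negP: f0; apply/eqP/fpsP => i.
  by apply/eqP/negPn/negP/f_all0.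
exists (ex_minn exf); case: ex_minnP => // m _ min_m i lt_im.
by apply/eqP/negPn/negP => /min_m; rewrite leqNgt lt_im.
Qed.

Fact fps_integral : GRing.integral_domain_axiom {fps R}.
Proof.
move=> f g fg0; apply/negPn; rewrite negb_or; apply/negP.
case/andP=> /fps_neq0P[i fi0 f_lt] /fps_neq0P[j gj0 g_lt].
move/fpsP/(_ (i + j)%N): fg0; rewrite fpsME.
have lt_i : (i < (i + j).+1)%N by rewrite ltnS leq_addr.
rewrite (bigD1 (Ordinal lt_i)) //= addKn big1 ?addr0.
  by move/eqP; rewrite mulf_eq0 (negPf fi0) (negPf gj0).
move=> k; rewrite -val_eqE /= neq_ltn => /orP[lt_ki|lt_ik].
  by rewrite f_lt // mul0r.
by rewrite g_lt ?mulr0 // ltn_subLR ?ltn_add2r // -ltnS.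
Qed.

HB.instance Definition _ :=
  GRing.ComUnitRing_isIntegral.Build {fps R} fps_integral.

End FpsDomain.

Definition fps_map (R S : Type) (phi : R -> S) (f : {fps R}) : {fps S} :=
  Fps (phi \o f).

Section FpsMorphisms.
Variables R S : comNzRingType.

Lemma fps_derivD : {morph @fps_deriv R : f g / f + g}.
Proof. by move=> f g; apply/fpsP => i /=; rewrite mulrnDl. Qed.

Lemma fps_derivM (f g : {fps R}) :
  fps_deriv (f * g) = fps_deriv f * g + f * fps_deriv g.
Proof.
apply/fpsP => n.
have truncD (h : {fps R}) i : (i < n.+2)%N ->
  ((fps_trunc n.+3 h)^`())`_i = fps_deriv h i.
  by move=> lt_i; rewrite coef_deriv coef_fps_trunc.
have -> : fps_deriv (f * g) n = ((fps_trunc n.+3 f * fps_trunc n.+3 g)^`())`_n.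
  by rewrite coef_deriv -fps_mul_trunc.
rewrite derivM coefD !coefM.
congr (_ + _); apply: eq_bigr => i _; rewrite truncD ?coef_fps_trunc //.
all: by have := ltn_ord i; lia.
Qed.

Variable phi : {rmorphism R -> S}.

Fact fps_map_zmod_morphism : zmod_morphism (fps_map phi).
Proof. by move=> f g; apply/fpsP => i /=; rewrite rmorphB. Qed.

Fact fps_map_monoid_morphism : monoid_morphism (fps_map phi).
Proof.
split=> [|f g]; apply/fpsP => n /=; first by case: eqP; rewrite ?rmorph1 ?rmorph0.
by rewrite rmorph_sum; apply: eq_bigr => i _; rewrite rmorphM.
Qed.

HB.instance Definition _ :=
  GRing.isZmodMorphism.Build {fps R} {fps S} (fps_map phi) fps_map_zmod_morphism.
HB.instance Definition _ :=
  GRing.isMonoidMorphism.Build {fps R} {fps S} (fps_map phi)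
    fps_map_monoid_morphism.

Lemma fps_map_inj : injective phi -> injective (fps_map phi).
Proof.
by move=> phi_inj f g /fpsP fg; apply/fpsP => i; apply/phi_inj/fg.
Qed.

End FpsMorphisms.

Notation "x %:F" := (FracField.tofrac x) : ring_scope.

Section FractionExtension.
Variables R S : idomainType.
Implicit Types f : {fraction R}.

Lemma frac_reprE f : f = (\n_(repr f))%:F / (\d_(repr f))%:F.
Proof.
rewrite -[f in LHS]reprK; move: (repr f) => x.
have d0 : \d_x != 0 := denom_ratioP x.
apply: (@mulIf _ (\d_x)%:F); first by rewrite tofrac_eq0.
rewrite divfK ?tofrac_eq0 //.
unlock FracField.tofrac; rewrite -[LHS]FracField.pi_mul.
apply/eqmodP; rewrite /= FracField.equivfE /FracField.mulf.
by rewrite !numden_Ratio ?mulf_neq0 ?oner_eq0 // !mulr1 mulrC.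
Qed.

Lemma frac_repr_eq (a b : R) : b != 0 ->
  \n_(repr (a%:F / b%:F)) * b = a * \d_(repr (a%:F / b%:F)).
Proof.
move=> b0; set f := a%:F / b%:F.
have d0 := denom_ratioP (repr f).
apply/eqP; rewrite -tofrac_eq !tofracM; apply/eqP.
move: (frac_reprE f); rewrite {1}/f => /eqP.
by rewrite eqr_div ?tofrac_eq0 // => /eqP <-.
Qed.

(* Defined on representatives; frac_mapE and frac_derivE show that the result
   does not depend on them. *)
Definition frac_map (phi : R -> S) f : {fraction S} :=
  (phi \n_(repr f))%:F / (phi \d_(repr f))%:F.

Definition frac_deriv (d : R -> R) f : {fraction R} :=
  (d \n_(repr f) * \d_(repr f) - \n_(repr f) * d \d_(repr f))%:F
    / (\d_(repr f) ^+ 2)%:F.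

Lemma frac_mapE (phi : {rmorphism R -> S}) (a b : R) :
  injective phi -> b != 0 ->
  frac_map phi (a%:F / b%:F) = (phi a)%:F / (phi b)%:F.
Proof.
move=> phi_inj b0; rewrite /frac_map.
have d0 := denom_ratioP (repr (a%:F / b%:F)).
have phi0 u : u != 0 -> phi u != 0.
  by apply: contra_neq => phiu0; apply: phi_inj; rewrite phiu0 rmorph0.
apply/eqP; rewrite eqr_div ?tofrac_eq0 ?phi0 //.
by rewrite -!tofracM -!rmorphM frac_repr_eq.
Qed.

Lemma frac_derivE (d : R -> R) (a b : R) :
  (forall u v, d (u * v) = d u * v + u * d v) -> b != 0 ->
  frac_deriv d (a%:F / b%:F) = (d a * b - a * d b)%:F / (b ^+ 2)%:F.
Proof.
move=> dM b0; rewrite /frac_deriv.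
have m0 := denom_ratioP (repr (a%:F / b%:F)).
have nbE := frac_repr_eq a b0.
move: (\n_ _) (\d_ _) m0 nbE => n m m0 nbE.
apply/eqP; rewrite eqr_div ?tofrac_eq0 ?expf_neq0 // -!tofracM tofrac_eq.
have dE := congr1 d nbE; rewrite !dM in dE.
rewrite -(inj_eq (mulfI m0)) -(inj_eq (mulfI b0)); apply/eqP.
have -> : b * (m * ((d n * m - n * d m) * b ^+ 2)) =
  b ^+ 2 * m * ((d n * b + n * d b) * m - n * b * d m - n * d b * m).
  by ring.
rewrite dE nbE.
have -> : b ^+ 2 * m * ((d a * m + a * d m) * m - a * m * d m - n * d b * m) =
  b * m ^+ 2 * (b * m * d a - n * b * d b).
  by ring.
by rewrite nbE; ring.
Qed.

End FractionExtension.

(* k((x)) is the fraction field of k[[x]]. *)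
Notation "{ 'laurent' k }" := {fraction {fps k}}
  (at level 0, format "{ 'laurent'  k }") : type_scope.

Section Laurent.
Variable k : fieldType.
Implicit Types f : {laurent k}.

Definition no_pole f : Prop := exists a : {fps k}, f = a%:F.

(* f|_{x=0}; the junk value 0 is used when f has a pole. *)
Definition at0 f : k := (xget 0 [set a : {fps k} | f = a%:F]%classic) 0%N.

Lemma at0_tofrac (a : {fps k}) : at0 a%:F = a 0%N.
Proof.
rewrite /at0; set P := [set _ | _]%classic.
have /eqP : P (xget 0 P) by apply: (@xgetI _ _ _ a).
by rewrite tofrac_eq => /eqP <-.
Qed.

Lemma fps_factorX (f : {fps k}) : f != 0 ->
  exists (m : nat) (u : {fps k}), u \is a GRing.unit /\ f = fpsX ^+ m * u.
Proof.
case/fps_neq0P=> m; elim: m f => [|m IHm] f fm0 lt_f.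
  by exists 0%N, f; rewrite mul1r fps_unitE unitfE.
have [|j [u [Uu fE]]] := IHm (Fps (fun i => f i.+1)) fm0.
  by move=> i lt_im; apply: lt_f.
exists j.+1, u; split=> //; rewrite exprS -mulrA -fE.
apply/fpsP => -[|i].
  by rewrite fpsME big_ord1 mul0r lt_f.
rewrite fpsME !big_ord_recl /= mul0r mul1r add0r subSS subn0 big1 ?addr0 //.
by move=> l _; rewrite mul0r.
Qed.

Lemma ex_no_pole f : exists p : nat, no_pole (fpsX%:F ^+ p * f).
Proof.
have [m [u [Uu dE]]] := fps_factorX (denom_ratioP (repr f)).
exists m, (\n_(repr f) * u^-1); rewrite [in LHS](frac_reprE f) dE.
have X0 : fpsX != 0 :> {fps k}.
  by apply/eqP => /fpsP /(_ 1%N) /eqP; rewrite oner_eq0.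
have u0 : u != 0 by apply: contraTneq Uu => ->; rewrite unitr0.
have Xm0 : (fpsX : {fps k})%:F ^+ m != 0 by rewrite expf_neq0 ?tofrac_eq0.
have uF0 : u%:F != 0 by rewrite tofrac_eq0.
apply: (mulIf uF0); rewrite -[RHS]tofracM mulrVK // tofracM tofracXn.
by rewrite invfM -!mulrA mulVf // mulr1 mulrCA mulfV // mulr1.
Qed.

Lemma no_poleXM p f : no_pole f -> no_pole (fpsX%:F ^+ p * f).
Proof. by case=> a ->; exists (fpsX ^+ p * a); rewrite tofracM tofracXn. Qed.

Variable n : nat.
Implicit Types M : 'M[{laurent k}]_n.

Definition no_pole_mx M : Prop := forall i j, no_pole (M i j).

Lemma ex_no_pole_mx M : exists p : nat, `[< no_pole_mx (fpsX%:F ^+ p *: M) >].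
Proof.
pose p i j := xget 0%N [set p : nat | no_pole (fpsX%:F ^+ p * M i j)]%classic.
have pP i j : no_pole (fpsX%:F ^+ p i j * M i j).
  exact: (xgetPex 0%N (ex_no_pole (M i j))).
exists (\sum_i \sum_j p i j)%N; apply/asboolP => i j; rewrite mxE.
rewrite (bigD1 i) //= (bigD1 j) //= -addnA addnC exprD -mulrA.
exact/no_poleXM/pP.
Qed.

Definition pole_order M : nat := ex_minn (ex_no_pole_mx M).

(* The matrix C_0 in M = x^-p (C_0 + C_1 x + ...). *)
Definition lead_mx (p : nat) M : 'M[k]_n := map_mx at0 (fpsX%:F ^+ p *: M).

Definition laurent_moser_rank M : rat :=
  let p := pole_order M in
  Num.max 0 (p%:R + (\rank (lead_mx p M))%:R / n%:R).

End Laurent.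

Notation Cy R := {fps (complex R)}.
(* C[[x,y]] = C[[y]][[x]]: (f i) j is the coefficient of x^i y^j. *)
Notation Cxy R := {fps {fps (complex R)}}.
Notation Kxy R := {fraction Cxy R}.

Section Pfaffian.
Variable R : realType.

Definition Kx : Kxy R := fpsX%:F.
Definition Ky : Kxy R := (fpsC fpsX)%:F.

Definition dx : Kxy R -> Kxy R := frac_deriv (@fps_deriv (Cy R)).
Definition dy : Kxy R -> Kxy R :=
  frac_deriv (fps_map (@fps_deriv (complex R))).

(* The embedding of Frac C[[y]][[x]] in C((y))((x)), with C((y)) = Frac C[[y]]. *)
Definition laurent_x : Kxy R -> {laurent {fraction Cy R}} :=
  frac_map (fps_map (@FracField.tofrac (Cy R))).

Variable n : nat.
Implicit Types (A B T : 'M[Kxy R]_n) (M : 'M[Cxy R]_n).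

Definition xcoef_mx (i : nat) M : 'M[Cy R]_n :=
  map_mx (fun f : Cxy R => f i) M.
Definition ycoef_mx (j : nat) M : 'M[{fps (complex R)}]_n :=
  map_mx (fun f : Cxy R => Fps (fun i => f i j)) M.

Definition mx_of_Cxy M : 'M[Kxy R]_n := map_mx (@FracField.tofrac (Cxy R)) M.
Definition mx_of_Cy (U : 'M[Cy R]_n) : 'M[Kxy R]_n :=
  map_mx (fun f : Cy R => (fpsC f)%:F) U.

Record normal_crossings_system (p q : nat) A B (Ahat Bhat : 'M[Cxy R]_n) :
    Prop := NormalCrossingsSystem {
  nc_A : A = Kx ^- p *: mx_of_Cxy Ahat;
  nc_B : B = Ky ^- q *: mx_of_Cxy Bhat;
  nc_A0 : xcoef_mx 0 Ahat != 0;
  nc_B0 : ycoef_mx 0 Bhat != 0;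
  nc_integrable :
    Kx *: map_mx dx B + B *m A = Ky *: map_mx dy A + A *m B
}.

Definition gauge_x T A : 'M[Kxy R]_n :=
  invmx T *m (A *m T - Kx *: map_mx dx T).
Definition gauge_y T B : 'M[Kxy R]_n :=
  invmx T *m (B *m T - Ky *: map_mx dy T).

Definition moser_rank A : rat := laurent_moser_rank (map_mx laurent_x A).

Definition is_moser_invariant A (mu : rat) : Prop :=
  (exists2 T, T \in unitmx & mu = moser_rank (gauge_x T A)) /\
  (forall T, T \in unitmx -> mu <= moser_rank (gauge_x T A)).

Definition moser_invariant A : rat := xget 0 (is_moser_invariant A).

Lemma moser_invariantP A : is_moser_invariant A (moser_invariant A).
Proof.
apply: xgetPex.
pose N T := map_mx laurent_x (gauge_x T A).
pose v T := (pole_order (N T) * n + \rank (lead_mx (pole_order (N T)) (N T)))%N.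
have exv : exists m, `[< exists2 T, T \in unitmx & m = v T >].
  by exists (v 1%:M); apply/asboolP; exists 1%:M; rewrite ?unitmx1.
case: (ex_minnP exv) => m /asboolP[T UT ->] min_v.
exists (moser_rank (gauge_x T A)); split; first by exists T.
move=> T' UT'; case: (posnP n) => [n0|n_gt0].
  suff -> : gauge_x T A = gauge_x T' A by [].
  by apply/matrixP => -[i lt_i]; exfalso; rewrite n0 in lt_i.
have mE S : moser_rank (gauge_x S A) = (v S)%:R / n%:R.
  rewrite /moser_rank /laurent_moser_rank -/(N S) max_r.
    by rewrite /v natrD natrM mulrDl mulfK // pnatr_eq0 -lt0n.
  by rewrite addr_ge0 // divr_ge0.
have le_subst (a b c d : rat) : a = b -> c = d -> b <= d -> a <= c by move=> -> ->.
apply: (le_subst _ _ _ _ (mE T) (mE T')).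
have le_v : (v T <= v T')%N by apply: min_v; apply/asboolP; exists T'.
move: (v T) (v T') le_v => a b le_ab.
by rewrite ler_pM2r ?invr_gt0 ?ltr0n // ler_nat.
Qed.

Definition moser_reducible A : Prop := moser_invariant A < moser_rank A.

(* T[A] = x^-p (A~_0 + A~_1 x + ...) over C((y)), with rank A~_0 < r. *)
Definition reduces_rank (p r : nat) A T : Prop :=
  let TA := map_mx laurent_x (gauge_x T A) in
  no_pole_mx (fpsX%:F ^+ p *: TA) /\ (\rank (lead_mx p TA) < r)%N.

Definition compatible_y (q : nat) B T : Prop :=
  exists M, Ky ^+ q *: gauge_y T B = mx_of_Cxy M.

Inductive unimodular_shearing_product : 'M[Kxy R]_n -> Prop :=
| USP_unimodular (U : 'M[Cy R]_n) of U \in unitmx :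
    unimodular_shearing_product (mx_of_Cy U)
| USP_shearing (alpha : 'I_n -> nat) :
    unimodular_shearing_product (diag_mx (\row_i Kx ^+ alpha i))
| USP_mul T1 T2 of unimodular_shearing_product T1
                 & unimodular_shearing_product T2 :
    unimodular_shearing_product (T1 *m T2).

(* When r is the rank of A0, the product below has no pole in x: the term of
   degree -i in x of the determinant involves minors of order i of A0. *)
Definition moser_theta (r : nat) (A0 A1 : 'M[Cy R]_n) :
    {poly {fraction Cy R}} :=
  map_poly (fun f => at0 (laurent_x f))
    ((Kx ^+ r)%:P *
     \det ('X%:M + map_mx polyC (Kx^-1 *: mx_of_Cy A0 + mx_of_Cy A1))).

End Pfaffian.

(* Main.v *)
Require Import Defs.
From HB Require Import structures.
From mathcomp Require Import all_boot all_order all_algebra zify ring.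
From mathcomp Require Import perm fraction complex.
From mathcomp Require Import boolp classical_sets reals.

Set Implicit Arguments.
Unset Strict Implicit.
Unset Printing Implicit Defensive.

Import Order.TTheory GRing.Theory Num.Theory.
Local Open Scope ring_scope.

(** Write [k] for the fraction field of [C[[y]]] and [a0], [a1] for the transposes
    of [A_0], [A_1], so that subspaces are row spaces.  Everything is controlled by
    the map [lambda + a1] from the kernel of [a0] to its cokernel, two spaces of
    dimension [n - r]: up to a nonzero constant, [theta] is its determinant
    ([pencil_numerator], [theta_formula]).

    Necessity.  Over the valuation ring [k[[x]]], a gauge transformation [T] has a
    Smith factorization [P D Q] ([laurent_smith]).  The determinant
    [det (lambda + x^(p-1) A)] is invariant under conjugation; what a gauge
    transformation adds to a conjugation are the logarithmic derivatives of [P],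
    [D] and [Q], which have no pole, so that after multiplication by [x^(p-1)] they
    affect neither the leading coefficient nor, in the case of [P], the next one.
    Hence [theta] can be computed from [T[A]], and it vanishes when the leading
    coefficient of [T[A]] has rank less than [r] ([theta_gauge_eq0]).

    Sufficiency.  If [theta] vanishes, the pencil has a polynomial null vector.  Its
    coefficients span a subspace [V] of the kernel of [a0] with
    [V a1 <= V + a0], which meets the image of [a0] ([deflating_of_det0]).  Such
    subspaces, here called deflating, are stable under sums, so there is a largest
    one, [W] ([max_deflating]).  The integrability condition at the first two orders
    in [x] says that the second equation defines, at [x = 0], a connection on [k^n]
    compatible with [a0] and [a1]; adding to a deflating subspace its image under
    the connection gives a deflating subspace again ([connection_deflating]), and
    therefore [W] is stable under the connection.

    Since [C[[y]]] is a valuation ring, [W] is spanned over [k] by part of a basis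
    [Q] of the lattice [C[[y]]^n] ([saturated_basis]).  The transformation is
    [Q^T] followed by the shearing which multiplies by [x] the basis vectors outside
    [W] ([unimodular_shear]).  No pole in [x] appears in [x^p T[A]] because [a0]
    kills [W], and none appears in [y^q T[B]] because [W] is stable under the
    connection.  The new leading coefficient factors through [a0] followed by the
    projection along [W], so that its rank drops as [W] meets the image of [a0]
    ([shear_rank], [reduction_basis]).

    Finally, the rank of a leading coefficient being at most [n], Moser ranks compare
    lexicographically ([laurent_moser_rank_lt]): for [p > 0], which is what
    [m(A) > 1] gives, being Moser-reducible amounts to the existence of a [T]
    lowering the rank of the coefficient of [x^-p]. *)

(** * Formal power series *)

Section FpsCoefficients.
Variable R : comNzRingType.
Implicit Types f g : {fps R}.

Definition fps_coef0 f : R := f 0%N.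

Fact fps_coef0_zmod_morphism : zmod_morphism fps_coef0.
Proof. by []. Qed.
Fact fps_coef0_monoid_morphism : monoid_morphism fps_coef0.
Proof. by split=> // f g; rewrite /fps_coef0 fpsME big_ord1. Qed.
HB.instance Definition _ :=
  GRing.isZmodMorphism.Build {fps R} R fps_coef0 fps_coef0_zmod_morphism.
HB.instance Definition _ :=
  GRing.isMonoidMorphism.Build {fps R} R fps_coef0 fps_coef0_monoid_morphism.

Fact fpsC_zmod_morphism : zmod_morphism (@fpsC R).
Proof. by move=> a b; apply/fpsP => -[|i] //=; rewrite subr0. Qed.
Fact fpsC_monoid_morphism : monoid_morphism (@fpsC R).
Proof.
split=> // a b; apply/fpsP => n; rewrite fpsME big_ord_recl /= subn0.
rewrite big1 ?addr0 => [|i _]; last by rewrite mul0r.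
by case: n => //= n; rewrite mulr0.
Qed.
HB.instance Definition _ :=
  GRing.isZmodMorphism.Build R {fps R} (@fpsC R) fpsC_zmod_morphism.
HB.instance Definition _ :=
  GRing.isMonoidMorphism.Build R {fps R} (@fpsC R) fpsC_monoid_morphism.

Lemma fpsDE f g i : (f + g) i = f i + g i. Proof. by []. Qed.

Lemma fps_sumE (I : Type) (s : seq I) (P : pred I) (F : I -> {fps R}) i :
  (\sum_(j <- s | P j) F j) i = \sum_(j <- s | P j) F j i.
Proof. by elim/big_rec2: _ => // j a b _ <-. Qed.

Lemma fpsCME (c : R) f i : (fpsC c * f) i = c * f i.
Proof.
rewrite fpsME big_ord_recl /= subn0 big1 ?addr0 // => j _.
by rewrite mul0r.
Qed.

Lemma fpsM1E f g : (f * g) 1%N = f 0%N * g 1%N + f 1%N * g 0%N.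
Proof. by rewrite fpsME big_ord_recl big_ord1. Qed.

Lemma fpsXM0 f : (fpsX * f) 0%N = 0.
Proof. by rewrite fpsME big_ord1 mul0r. Qed.

Lemma fpsXME f i : (fpsX * f) i.+1 = f i.
Proof.
rewrite fpsME !big_ord_recl /= mul0r mul1r add0r subSS subn0 big1 ?addr0 //.
by move=> j _; rewrite mul0r.
Qed.

Definition fps_shift f : {fps R} := Fps (fun i => f i.+1).

Lemma fps_shiftE f : f = fpsC (f 0%N) + fpsX * fps_shift f.
Proof.
apply/fpsP => -[|i]; rewrite fpsDE ?fpsXM0 ?fpsXME /=.
  by rewrite addr0.
by rewrite add0r.
Qed.

Lemma fps_shift0 f : f 0%N = 0 -> f = fpsX * fps_shift f.
Proof. by move=> f0; rewrite [LHS]fps_shiftE f0 rmorph0 add0r. Qed.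

Lemma fpsX_neq0 : fpsX != 0 :> {fps R}.
Proof. by apply/eqP => /fpsP /(_ 1%N) /eqP; rewrite oner_eq0. Qed.

Lemma fps_derivC (c : R) : fps_deriv (fpsC c) = 0.
Proof. by apply/fpsP => i /=; rewrite mul0rn. Qed.

End FpsCoefficients.

Section FpsMatrices.
Variable R : comNzRingType.

Definition coef_mx m n i (H : 'M[{fps R}]_(m, n)) : 'M[R]_(m, n) :=
  map_mx (fun f : {fps R} => f i) H.

Lemma coef_mxD m n i (H K : 'M_(m, n)) :
  coef_mx i (H + K) = coef_mx i H + coef_mx i K.
Proof. by apply/matrixP => j k; rewrite !mxE. Qed.

Lemma coef_mxN m n i (H : 'M_(m, n)) : coef_mx i (- H) = - coef_mx i H.
Proof. by apply/matrixP => j k; rewrite !mxE. Qed.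

Lemma coef_mx_tr m n i (H : 'M_(m, n)) : coef_mx i H^T = (coef_mx i H)^T.
Proof. by apply/matrixP => j l; rewrite !mxE. Qed.

Lemma coef_mx0M m n p (H : 'M_(m, n)) (K : 'M_(n, p)) :
  coef_mx 0 (H *m K) = coef_mx 0 H *m coef_mx 0 K.
Proof. exact: (map_mxM (@fps_coef0 R)). Qed.

Lemma coef_mx0Z m n (a : {fps R}) (H : 'M_(m, n)) :
  coef_mx 0 (a *: H) = a 0%N *: coef_mx 0 H.
Proof. exact: (map_mxZ (@fps_coef0 R)). Qed.

Lemma coef_mx1M m n p (H : 'M_(m, n)) (K : 'M_(n, p)) :
  coef_mx 1 (H *m K) =
    coef_mx 0 H *m coef_mx 1 K + coef_mx 1 H *m coef_mx 0 K.
Proof.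
apply/matrixP => i j; rewrite !mxE fps_sumE -big_split.
by apply: eq_bigr => l _; rewrite fpsM1E !mxE.
Qed.

Lemma coef_mxXn m n i e (H : 'M_(m, n)) : (i < e)%N ->
  coef_mx i (fpsX ^+ e *: H) = 0.
Proof.
elim: e i => // e IHe [|i] lt_ie; apply/matrixP => j l; rewrite !mxE exprS -mulrA.
  exact: fpsXM0.
rewrite fpsXME; have /matrixP/(_ j l) := IHe i lt_ie.
by rewrite !mxE.
Qed.

Lemma coef_mxDXn m n i e (H K : 'M_(m, n)) : (i < e)%N ->
  coef_mx i (H + fpsX ^+ e *: K) = coef_mx i H.
Proof. by move=> lt_ie; rewrite coef_mxD (coef_mxXn K lt_ie) addr0. Qed.

Definition constant_mx m n (M : 'M[R]_(m, n)) : 'M[{fps R}]_(m, n) :=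
  map_mx (@fpsC R) M.

Lemma coef_mx0C m n (M : 'M[R]_(m, n)) : coef_mx 0 (constant_mx M) = M.
Proof. by apply/matrixP => i j; rewrite !mxE. Qed.

Lemma coef_mx1C m n (M : 'M[R]_(m, n)) : coef_mx 1 (constant_mx M) = 0.
Proof. by apply/matrixP => i j; rewrite !mxE. Qed.

Lemma shift_mxE m n (H : 'M[{fps R}]_(m, n)) :
  H = constant_mx (coef_mx 0 H) + fpsX *: map_mx (@fps_shift R) H.
Proof. by apply/matrixP => i j; rewrite !mxE -fps_shiftE. Qed.

End FpsMatrices.

(** * Derivations and gauge transformations *)

Section MatrixDerivation.
Variables (L : comNzRingType) (d : L -> L).
Hypothesis dD : {morph d : u v / u + v}.
Hypothesis dM : forall u v, d (u * v) = d u * v + u * d v.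

Lemma derivation0 : d 0 = 0.
Proof. by apply: (addrI (d 0)); rewrite -dD !addr0. Qed.

Lemma derivation1 : d 1 = 0.
Proof. by apply: (addrI (d 1)); have := dM 1 1; rewrite !mulr1 mul1r addr0. Qed.

Lemma derivation_sum (I : Type) (s : seq I) (P : pred I) (F : I -> L) :
  d (\sum_(i <- s | P i) F i) = \sum_(i <- s | P i) d (F i).
Proof. exact: (big_morph d dD derivation0). Qed.

Lemma derivation_mulmx m n p (M : 'M[L]_(m, n)) (N : 'M[L]_(n, p)) :
  map_mx d (M *m N) = map_mx d M *m N + M *m map_mx d N.
Proof.
apply/matrixP => i j; rewrite !mxE derivation_sum -big_split /=.
by apply: eq_bigr => l _; rewrite dM !mxE.
Qed.

Lemma derivation_addmx m n (M N : 'M[L]_(m, n)) :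
  map_mx d (M + N) = map_mx d M + map_mx d N.
Proof. by apply/matrixP => i j; rewrite !mxE dD. Qed.

Lemma derivation_scalemx m n (c : L) (M : 'M[L]_(m, n)) :
  map_mx d (c *: M) = d c *: M + c *: map_mx d M.
Proof. by apply/matrixP => i j; rewrite !mxE dM. Qed.

End MatrixDerivation.

Section Invmx.
Variables (L : comUnitRingType) (n : nat).
Implicit Types (M N : 'M[L]_n).

Lemma invmx_unique M N : M *m N = 1%:M -> invmx M = N.
Proof.
by move=> MN1; have [UM _] := mulmx1_unit MN1; rewrite -[N](mulKmx UM) MN1 mulmx1.
Qed.

Lemma invmx_mulmx M N : M \in unitmx -> N \in unitmx ->
  invmx (M *m N) = invmx N *m invmx M.
Proof.
by move=> UM UN; apply: invmx_unique; rewrite mulmxA mulmxK // mulmxV.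
Qed.

End Invmx.

Lemma map_unitmx_inv (L L' : comUnitRingType) (f : {rmorphism L -> L'}) n
    (M : 'M[L]_n) :
  M \in unitmx ->
  (map_mx f M \in unitmx) * (invmx (map_mx f M) = map_mx f (invmx M)).
Proof.
move=> UM; have e : map_mx f M *m map_mx f (invmx M) = 1%:M.
  by rewrite -map_mxM mulmxV // map_mx1.
by split; [case: (mulmx1_unit e) | apply: invmx_unique].
Qed.

Section Gauge.
Variables (L : fieldType) (d : L -> L).
Hypothesis dD : {morph d : u v / u + v}.
Hypothesis dM : forall u v, d (u * v) = d u * v + u * d v.
Variable n : nat.
Implicit Types (A T : 'M[L]_n).

(** The substitution [Y = T Z] in [d Y = A Y]. *)
Definition gauge T A : 'M[L]_n := invmx T *m (A *m T - map_mx d T).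

Lemma gaugeM T1 T2 A : T1 \in unitmx -> T2 \in unitmx ->
  gauge (T1 *m T2) A = gauge T2 (gauge T1 A).
Proof.
move=> U1 U2; rewrite /gauge invmx_mulmx // (derivation_mulmx dD dM).
rewrite -mulmxA; congr (_ *m _); rewrite -mulmxA !mulmxBl !mulmxBr !mulmxDr.
by rewrite !mulmxA mulVmx // mul1mx opprD addrA.
Qed.

Lemma gaugeK T A : T \in unitmx ->
  invmx T *m A *m T = gauge T A + invmx T *m map_mx d T.
Proof. by move=> UT; rewrite /gauge mulmxBr mulmxA subrK. Qed.

End Gauge.

Lemma map_gauge (L L' : fieldType) (g : {rmorphism L -> L'}) (d : L -> L)
    (d' : L' -> L') n (T A : 'M[L]_n) : (forall u, g (d u) = d' (g u)) ->
  map_mx g (gauge d T A) = gauge d' (map_mx g T) (map_mx g A).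
Proof.
move=> gd; rewrite /gauge map_mxM map_invmx map_mxB map_mxM.
by congr (_ *m (_ - _)); apply/matrixP => i j; rewrite !mxE; apply: gd.
Qed.

(** * Fractions *)

Lemma cancel_denominator (L : fieldType) (u a b c e : L) : a != 0 ->
  a * b * c * (u / a) = u * (c * b).
Proof. by move=> a0; field. Qed.

Section Fractions.
Variables (R S : idomainType).

Lemma fracP (f : {fraction R}) : exists a b : R, b != 0 /\ f = a%:F / b%:F.
Proof.
exists (\n_(repr f)), (\d_(repr f)); split; first exact: denom_ratioP.
exact: frac_reprE.
Qed.

Lemma common_denominator m n (M : 'M[{fraction R}]_(m, n)) :
  exists c (N : 'M[R]_(m, n)),
    c != 0 /\ c%:F *: M = map_mx (@FracField.tofrac R) N.
Proof.
pose den i j := \d_(repr (M i j)).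
exists (\prod_i \prod_j den i j).
exists (\matrix_(i, j) (\n_(repr (M i j)) *
  ((\prod_(k | k != i) \prod_l den k l) * \prod_(l | l != j) den i l))).
split.
  by apply/prodf_neq0 => i _; apply/prodf_neq0 => j _; apply: denom_ratioP.
apply/matrixP => i j; rewrite !mxE (bigD1 i) //= (bigD1 j) //=.
rewrite [M i j in LHS]frac_reprE -/(den i j) !tofracM.
have d0 : (den i j)%:F != 0 by rewrite tofrac_eq0 denom_ratioP.
set b := (\prod_(_ | _) _)%:F; set c := (\prod_(_ | _) _)%:F.
exact: cancel_denominator.
Qed.

Section FracMap.
Variable phi : {rmorphism R -> S}.
Hypothesis phi_inj : injective phi.

Lemma inj_rmorph_neq0 u : u != 0 -> phi u != 0.
Proof. by apply: contra_neq => u0; apply: phi_inj; rewrite u0 rmorph0. Qed.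

Lemma frac_map_tofrac a : frac_map phi a%:F = (phi a)%:F.
Proof.
have := frac_mapE a phi_inj (oner_neq0 R).
by rewrite !rmorph1 !divr1.
Qed.

Lemma frac_map_zmod_morphism : zmod_morphism (frac_map phi).
Proof.
move=> f g; have [a [b [b0 ->]]] := fracP f; have [u [v [v0 ->]]] := fracP g.
rewrite -mulNr addf_div ?tofrac_eq0 // -tofracN -!tofracM -tofracD.
rewrite !frac_mapE ?mulf_neq0 // rmorphD !rmorphM rmorphN.
by rewrite -[RHS]/(_ + - _) -mulNr addf_div ?tofrac_eq0 ?inj_rmorph_neq0 // -tofracN
  -!tofracM -tofracD.
Qed.

Lemma frac_map_monoid_morphism : monoid_morphism (frac_map phi).
Proof.
split=> [|f g]; first by rewrite -tofrac1 frac_map_tofrac rmorph1.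
have [a [b [b0 ->]]] := fracP f; have [u [v [v0 ->]]] := fracP g.
rewrite mulf_div -!tofracM !frac_mapE ?mulf_neq0 // !rmorphM.
by rewrite mulf_div -!tofracM.
Qed.

End FracMap.

Section FracDeriv.
Variable d : R -> R.
Hypothesis dD : {morph d : u v / u + v}.
Hypothesis dM : forall u v, d (u * v) = d u * v + u * d v.

Lemma frac_deriv_tofrac a : frac_deriv d a%:F = (d a)%:F.
Proof.
have := frac_derivE a dM (oner_neq0 R).
by rewrite (derivation1 dM) mulr0 subr0 mulr1 expr1n !tofrac1 !divr1.
Qed.

Lemma frac_derivD : {morph frac_deriv d : f g / f + g}.
Proof.
move=> f g; have [a [b [b0 ->]]] := fracP f; have [u [v [v0 ->]]] := fracP g.
rewrite addf_div ?tofrac_eq0 // -!tofracM -tofracD !frac_derivE ?mulf_neq0 //.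
rewrite addf_div ?tofrac_eq0 ?expf_neq0 //.
rewrite -!tofracM -tofracD; apply/eqP.
rewrite eqr_div ?tofrac_eq0 ?mulf_neq0 ?expf_neq0 ?mulf_neq0 //.
rewrite -!tofracM tofrac_eq !dD !dM; apply/eqP; ring.
Qed.

Lemma frac_derivM f g :
  frac_deriv d (f * g) = frac_deriv d f * g + f * frac_deriv d g.
Proof.
have [a [b [b0 ->]]] := fracP f; have [u [v [v0 ->]]] := fracP g.
rewrite mulf_div -!tofracM !frac_derivE ?mulf_neq0 //.
rewrite !mulf_div -!tofracM addf_div ?tofrac_eq0 ?mulf_neq0 ?expf_neq0 //.
rewrite -!tofracM -tofracD; apply/eqP.
rewrite eqr_div ?tofrac_eq0 ?mulf_neq0 ?expf_neq0 ?mulf_neq0 //.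
rewrite -!tofracM tofrac_eq !dM; apply/eqP; ring.
Qed.

End FracDeriv.

Lemma frac_map_deriv (phi : {rmorphism R -> S}) (d : R -> R) (d' : S -> S) f :
    injective phi ->
    (forall u v, d (u * v) = d u * v + u * d v) ->
    (forall u v, d' (u * v) = d' u * v + u * d' v) ->
    (forall u, phi (d u) = d' (phi u)) ->
  frac_map phi (frac_deriv d f) = frac_deriv d' (frac_map phi f).
Proof.
move=> phi_inj dM dM' phid; have [a [b [b0 ->]]] := fracP f.
rewrite frac_derivE // !frac_mapE ?expf_neq0 //.
by rewrite frac_derivE ?inj_rmorph_neq0 // rmorphB !rmorphM !phid.
Qed.

End Fractions.

(** * Smith form over a power series ring *)

Definition smith_diagonalizable (R : comUnitRingType) n (M : 'M[R]_n) :=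
  exists P d Q, [/\ P \in unitmx, Q \in unitmx & M = P *m diag_mx d *m Q].

(** The pivot clears its row and column, and leaves a Schur complement. *)
Lemma schur_smith (R : comUnitRingType) n (a : R) (b : 'rV_n) (c : 'cV_n) (e : 'M_n) :
    smith_diagonalizable (e - a *: (c *m b)) ->
  smith_diagonalizable (block_mx a%:M (a *: b) (a *: c) e : 'M_(1 + n)).
Proof.
case=> P [d [Q [UP UQ PdQ]]].
exists (block_mx 1%:M 0 c 1%:M *m block_mx 1%:M 0 0 P), (row_mx a%:M d).
exists (block_mx 1%:M 0 0 Q *m block_mx 1%:M b 0 1%:M); split.
- by rewrite unitmx_mul block_diag_mx_unit unitmx1 UP unitmxE det_lblock !det1
    mulr1 unitr1.
- by rewrite unitmx_mul block_diag_mx_unit unitmx1 UQ unitmxE det_ublock !det1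
    mulr1 unitr1.
rewrite diag_mx_row !mulmx_block.
rewrite !(mul0mx, mulmx0, mul1mx, mulmx1, addr0, add0r).
have -> : diag_mx a%:M = a%:M :> 'M_1.
  by apply/matrixP => k l; rewrite !ord1 !mxE.
rewrite -!PdQ mul_scalar_mx mul_mx_scalar -scalemxAl.
by congr block_mx; rewrite addrC subrK.
Qed.

Section Smith.
Variable F : fieldType.

Lemma fps_factorXn m (f : {fps F}) : (forall i, (i < m)%N -> f i = 0) ->
  f = fpsX ^+ m * Fps (fun i => f (m + i)%N).
Proof.
elim: m => [|m IHm] f0; first by rewrite mul1r; apply/fpsP.
rewrite [LHS]IHm => [|i im]; last by apply: f0; apply: ltnW.
rewrite exprSr -mulrA; congr (_ * _); rewrite [LHS]fps_shift0 /=.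
  by congr (_ * _); apply/fpsP => i /=; rewrite addnS.
by rewrite addn0 f0.
Qed.

(** An entry of least valuation divides all the others: it serves as pivot. *)
Lemma fps_pivot m n (M : 'M[{fps F}]_(m, n)) : M != 0 ->
  exists i j (N : 'M[{fps F}]_(m, n)), M = M i j *: N.
Proof.
move=> M0; have exm : exists v, [exists i, exists j, M i j v != 0].
  apply: contrapT => noM; case/eqP: M0; apply/matrixP => i j; rewrite mxE.
  apply/fpsP => v; apply/eqP/negPn/negP => Mv; apply: noM; exists v.
  by apply/existsP; exists i; apply/existsP; exists j.
case: (ex_minnP exm) => v /existsP[i /existsP[j Mv]] min_v.
have Mlt k l e : (e < v)%N -> M k l e = 0.
  move=> lt_ev; apply/eqP/negPn/negP => Me.
  have /min_v : [exists i, exists j, M i j e != 0].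
    by apply/existsP; exists k; apply/existsP; exists l.
  by rewrite leqNgt lt_ev.
have ME k l := fps_factorXn (Mlt k l).
set s := fun k l => Fps (fun e => M k l (v + e)%N) in ME.
have Us : s i j \is a GRing.unit by rewrite fps_unitE /= addn0 unitfE.
exists i, j, (\matrix_(k, l) ((s i j)^-1 * s k l)).
by apply/matrixP => k l; rewrite !mxE ME [M i j]ME -mulrA mulVKr.
Qed.

Lemma fps_smith n (M : 'M[{fps F}]_n) : smith_diagonalizable M.
Proof.
elim: n M => [|n IHn] M.
  by exists 1%:M, 0, 1%:M; rewrite unitmx1; split=> //; apply/matrixP => -[].
have [->|M0] := eqVneq M 0.
  by exists 1%:M, 0, 1%:M; rewrite unitmx1 raddf0 mulmx0 mul0mx.
have [i [j [N MN]]] := fps_pivot M0.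
pose swap (D : 'M[{fps F}]_(1 + n)) : 'M_(1 + n) := xrow 0 i (xcol 0 j D).
set a := M i j in MN.
have swapE : swap M = block_mx a%:M (a *: ursubmx (swap N))
    (a *: dlsubmx (swap N)) (a *: drsubmx (swap N)).
  rewrite -[LHS]submxK; congr block_mx.
  - by apply/matrixP => k l; rewrite !ord1 !mxE eqxx lshift0 !tpermL.
  - by apply/matrixP => k l; rewrite {1}MN !mxE.
  - by apply/matrixP => k l; rewrite {1}MN !mxE.
  - by apply/matrixP => k l; rewrite {1}MN !mxE.
have /schur_smith := IHn (a *: drsubmx (swap N)
  - a *: (dlsubmx (swap N) *m ursubmx (swap N))).
rewrite -swapE => -[P [D [Q [UP UQ PDQ]]]].
have ME : M = tperm_mx 0 i *m swap M *m tperm_mx 0 j.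
  rewrite -xcolE -xrowE; apply/matrixP => k l; rewrite !mxE.
  by rewrite !tpermK.
change 'M[{fps F}]_n.+1 in (type of P); change 'M[{fps F}]_n.+1 in (type of Q).
change 'rV[{fps F}]_n.+1 in (type of D).
clearbody swap => {swapE}.
exists (tperm_mx 0 i *m P), D, (Q *m tperm_mx 0 j); split.
- by rewrite unitmx_mul unitmx_perm UP.
- by rewrite unitmx_mul unitmx_perm UQ.
- by rewrite {1}ME PDQ !mulmxA.
Qed.

End Smith.

(** * The determinant as a polynomial in lambda *)

Lemma det_pid_scale (A : comNzRingType) n r (x : A) : (r <= n)%N ->
  \det (pid_mx r + x *: copid_mx r : 'M[A]_n) = x ^+ (n - r).
Proof.
move=> le_rn.
have -> : pid_mx r + x *: copid_mx r =
    diag_mx (\row_(i < n) if (i < r)%N then 1 else x).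
  apply/matrixP => i j; rewrite !mxE -val_eqE /=; case: eqP => ij /=.
    by case: ltnP => _; rewrite /= ?subrr ?mulr0 ?addr0 // subr0 mulr1 add0r mulr1n.
  by rewrite subrr mulr0 addr0 mulr0n.
rewrite det_diag (eq_bigr (fun i : 'I_n => if (i < r)%N then 1 else x)).
  rewrite -(big_mkord xpredT (fun i => if (i < r)%N then 1 else x)).
  rewrite (big_cat_nat (n := r)) //= big_nat big1 ?mul1r => [|i /andP[_ ->]] //.
  rewrite big_nat (eq_bigr (fun=> x)) => [|i /andP[le_ri _]]; last first.
    by rewrite ltnNge le_ri.
  by rewrite -big_nat prodr_const_nat.
by move=> i _; rewrite mxE.
Qed.

Section DetPencil.
Variables (A : comUnitRingType) (n r : nat).
Hypothesis le_rn : (r <= n)%N.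
Implicit Types (x l : A) (L R H Y : 'M[A]_n).

(** The last [n - r] rows of the left-hand side are divisible by [x]. *)
Lemma pid_scale_factor x Y :
  pid_mx r + x *: Y = (pid_mx r + x *: copid_mx r)
    *m (pid_mx r + copid_mx r *m Y + x *: (pid_mx r *m Y)).
Proof.
have pp := @pid_mx_id A n n n r le_rn.
have pc := @mul_pid_mx_copid A n n r le_rn.
have cp := @mul_copid_mx_pid A n n r le_rn.
have cc := @copid_mx_id A n r le_rn.
have c1 : pid_mx r + copid_mx r = 1%:M :> 'M[A]_n by rewrite addrC subrK.
move: (pid_mx r) (copid_mx r) pp pc cp cc c1 => e f ee ef fe ff ef1.
rewrite !mulmxDl !mulmxDr -!(scalemxAl, scalemxAr) !mulmxA.
rewrite ee ef fe ff !mul0mx !scaler0 addr0 add0r addr0.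
by rewrite -addrA -scalerDr -mulmxDl ef1 mul1mx.
Qed.

Lemma det_pencil x l L R H : L \in unitmx -> R \in unitmx ->
  let Y := invmx L *m (l%:M + H) *m invmx R in
  \det ((x * l)%:M + (L *m pid_mx r *m R + x *: H)) =
  \det L * \det R * x ^+ (n - r) *
    \det (pid_mx r + copid_mx r *m Y + x *: (pid_mx r *m Y)).
Proof.
move=> UL UR Y.
have -> : (x * l)%:M + (L *m pid_mx r *m R + x *: H) =
    L *m (pid_mx r + x *: Y) *m R.
  rewrite mulmxDr mulmxDl addrCA; congr (_ + _).
  rewrite -scalemxAr -scalemxAl !mulmxA mulmxV // mul1mx mulmxKV //.
  by rewrite scalerDr scale_scalar_mx.
rewrite !det_mulmx pid_scale_factor det_mulmx det_pid_scale //; ring.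
Qed.

End DetPencil.

Section LambdaDet.
Variables (A : comNzRingType) (n : nat).

Definition lambda_det (M : 'M[A]_n) : {poly A} :=
  \det ('X%:M + map_mx polyC M).

End LambdaDet.

Lemma map_lambda_det (K L : comNzRingType) (g : {rmorphism K -> L}) n
    (N : 'M[K]_n) : map_poly g (lambda_det N) = lambda_det (map_mx g N).
Proof.
rewrite /lambda_det -det_map_mx; congr (\det _).
rewrite map_mxD map_scalar_mx /= map_polyX; congr (_ + _).
by apply/matrixP => i j; rewrite !mxE /= map_polyC.
Qed.

Lemma lambda_det_tr (K : comNzRingType) n (N : 'M[K]_n) :
  lambda_det N^T = lambda_det N.
Proof. by rewrite /lambda_det -[RHS]det_tr linearD /= tr_scalar_mx map_trmx. Qed.

Lemma map_poly_scaled_lambda_det (K L : comNzRingType) (k : nzRingType)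
    (g : {rmorphism K -> L}) (h : L -> k) (c : K) n (N : 'M[K]_n) : h 0 = 0 ->
  map_poly (fun u => h (g u)) (c%:P * lambda_det N) =
  map_poly h ((g c)%:P * lambda_det (map_mx g N)).
Proof.
move=> h0; rewrite -map_lambda_det -map_polyC -rmorphM.
by apply/polyP => i; rewrite !coef_map_id0 ?rmorph0 // coef_map.
Qed.

Section GaugeLambdaDet.
Variables (L : fieldType) (n : nat).
Implicit Types (M P D Q : 'M[L]_n).

Lemma lambda_det_conj P M : P \in unitmx ->
  lambda_det (invmx P *m M *m P) = lambda_det M.
Proof.
move=> UP; rewrite /lambda_det !map_mxM.
have PV : map_mx polyC (invmx P) *m map_mx polyC P = 1%:M :> 'M[{poly L}]_n.
  by rewrite -map_mxM mulVmx // map_mx1.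
move: (map_mx polyC (invmx P)) (map_mx polyC P) (map_mx polyC M) PV => V W N VW.
have -> : 'X%:M + V *m N *m W = V *m ('X%:M + N) *m W.
  by rewrite mulmxDr mulmxDl scalar_mxC -(mulmxA _%:M) VW mulmx1.
by rewrite !det_mulmx mulrAC -det_mulmx VW det1 mul1r.
Qed.

Variable d : L -> L.
Hypothesis dD : {morph d : u v / u + v}.
Hypothesis dM : forall u v, d (u * v) = d u * v + u * d v.

(** Each factor of a gauge transformation acts by conjugation, which [lambda_det]
    does not see, and subtracts its logarithmic derivative.  The matrix [G] is the
    system after the transformation [P] alone: only the effect of [P] has to be
    known to second order, and it is kept apart for that reason. *)
Lemma gauge_lambda_det (a : L) P D Q T M E1 E2 E3 :
    P \in unitmx -> Q \in unitmx -> D \in unitmx ->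
    invmx P *m map_mx d P = E1 -> invmx D *m map_mx d D = E2 ->
    invmx Q *m map_mx d Q = E3 -> T = P *m D *m Q ->
  exists G, [/\ invmx P *m (a *: M) *m P = a *: (G + E1),
    lambda_det (a *: M) = lambda_det (a *: (G + E1))
  & lambda_det (a *: G) =
      lambda_det (a *: (gauge d T M + (E3 + invmx Q *m E2 *m Q)))].
Proof.
move=> UP UQ UD <- <- <- ->; have UPD : P *m D \in unitmx by rewrite unitmx_mul UP.
have conjZ S N : invmx S *m (a *: N) *m S = a *: (invmx S *m N *m S).
  by rewrite -scalemxAr -scalemxAl.
have GK := gaugeK d M UP; exists (gauge d P M); split.
- by rewrite conjZ GK.
- by rewrite -GK -conjZ lambda_det_conj.
rewrite gaugeM // gaugeM //; set C := gauge d D _.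
rewrite -[LHS](lambda_det_conj _ UD) conjZ (gaugeK d) // -/C.
rewrite -[LHS](lambda_det_conj _ UQ) conjZ; congr (lambda_det (a *: _)).
by rewrite mulmxDr mulmxDl (gaugeK d) // addrA.
Qed.

End GaugeLambdaDet.

Section PencilAtZero.
Variables (F A B C : comUnitRingType) (n r : nat).
Variables (c : {rmorphism F -> A}) (f : {rmorphism A -> B}).
Variable e : {rmorphism A -> C}.
Implicit Types (L R : 'M[F]_n).

(** The pencil [l + H] from the kernel to the cokernel of [L diag(I_r, 0) R],
    completed by an identity block so as to remain an [n x n] matrix. *)
Definition reduced_pencil (c' : F -> C) (l : C) L R (H : 'M[C]_n) : 'M[C]_n :=
  pid_mx r + copid_mx r *m
    (map_mx c' (invmx L) *m (l%:M + H) *m map_mx c' (invmx R)).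

(** The ring [A] stands for the polynomials in lambda over power series in [x],
    while [f] inverts [x] and [e] evaluates at [x = 0].  When
    [A_0 = L diag(I_r, 0) R], the last [n - r] rows of
    [L^-1 (x lambda I + A_0 + x A_1 + ...) R^-1] are divisible by [x]; once they have
    been divided by [x], the matrix has a value at [x = 0], in which only [A_1]
    remains. *)
Lemma pencil_numerator (x l : A) L R (H : 'M[A]_n) (N : 'M[B]_n) :
    (r <= n)%N -> L \in unitmx -> R \in unitmx ->
    GRing.lreg (f x) -> e x = 0 ->
    f x *: N = map_mx f (map_mx c (L *m pid_mx r *m R) + x *: H) ->
  exists2 g, f x ^+ r * \det ((f l)%:M + N) = f g
    & e g = e (c (\det L * \det R))
        * \det (reduced_pencil (e \o c) (e l) L R (map_mx e H)).
Proof.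
move=> le_rn UL UR fx_reg ex0 NH.
have [UcL cLV] := map_unitmx_inv c UL; have [UcR cRV] := map_unitmx_inv c UR.
have := det_pencil le_rn x l H UcL UcR.
cbv zeta; set Y := invmx _ *m _ *m _; set g := \det (pid_mx r + _ + _) => detE.
exists (\det (map_mx c L) * \det (map_mx c R) * g).
  apply: (@lregX _ _ (n - r)%N fx_reg); rewrite mulrA -exprD subnK //.
  transitivity (f (\det (map_mx c L) * \det (map_mx c R) * x ^+ (n - r) * g)).
    rewrite -detE -det_map_mx -detZ; congr (\det _).
    rewrite scalerDr scale_scalar_mx map_mxD map_scalar_mx NH.
    by rewrite (rmorphM f) !map_mxM map_pid_mx.
  by rewrite !(rmorphM f) rmorphXn; ring.
rewrite (rmorphM e) !det_map_mx -(rmorphM c); congr (_ * _).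
rewrite /g -det_map_mx /reduced_pencil.
rewrite !map_mxD map_mxZ ex0 scale0r addr0 !map_mxM map_pid_mx map_copid_mx.
rewrite cLV cRV map_mxD map_scalar_mx.
by rewrite -!map_mx_comp.
Qed.

End PencilAtZero.

Section Theta.
Variables (F : fieldType) (n : nat).
Implicit Types (r : nat) (N : 'M[{laurent F}]_n) (H : 'M[{fps F}]_n).

Local Notation tf := (@FracField.tofrac {fps F}).
Local Notation X := (fpsX : {fps F}).

Definition theta r N : {poly F} :=
  map_poly (@at0 F) ((X%:F ^+ r)%:P * lambda_det N).

Lemma thetaE r N (g : {poly {fps F}}) :
  (X%:F ^+ r)%:P * lambda_det N = map_poly tf g ->
  theta r N = map_poly (@fps_coef0 F) g.
Proof.
rewrite /theta => ->; apply/polyP => i.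
have at00 : @at0 F 0 = 0 by rewrite -tofrac0 at0_tofrac.
by rewrite coef_map_id0 // coef_map at0_tofrac coef_map.
Qed.

Lemma theta_numerator r N H (L R : 'M[F]_n) :
    (r <= n)%N -> L \in unitmx -> R \in unitmx ->
    X%:F *: N = map_mx tf H ->
    coef_mx 0 H = L *m pid_mx r *m R ->
  exists2 g : {poly {fps F}},
    (X%:F ^+ r)%:P * lambda_det N = map_poly tf g
  & map_poly (@fps_coef0 F) g = (\det L * \det R)%:P *
      \det (reduced_pencil r polyC 'X L R (map_mx polyC (coef_mx 1 H))).
Proof.
move=> le_rn UL UR NH H0E.
pose c : {rmorphism F -> {poly {fps F}}} := polyC \o @fpsC F.
pose f : {rmorphism {poly {fps F}} -> {poly {laurent F}}} := map_poly tf.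
pose e : {rmorphism {poly {fps F}} -> {poly F}} := map_poly (@fps_coef0 F).
pose H1 := map_mx polyC (map_mx (@fps_shift F) H).
have fX : f X%:P = X%:F%:P by rewrite /f /= map_polyC.
have ec : e \o c = polyC by apply/funext => a; rewrite /= map_polyC.
have NH' : f X%:P *: map_mx polyC N =
    map_mx f (map_mx c (L *m pid_mx r *m R) + X%:P *: H1).
  rewrite -H0E fX; apply/matrixP => i j; rewrite !mxE.
  have := congr1 (fun M : 'M_n => M i j) NH; rewrite !mxE => NHij.
  rewrite -[LHS]polyCM NHij /c /= -polyCM -polyCD /f /= map_polyC /=.
  by congr (_ %:F)%:P; apply: fps_shiftE.
have fX_reg : GRing.lreg (f X%:P).
  by apply/lregP; rewrite fX polyC_eq0 tofrac_eq0 fpsX_neq0.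
have eX0 : e X%:P = 0 by rewrite /e /= map_polyC.
have [g gE eg] := pencil_numerator 'X le_rn UL UR fX_reg eX0 NH'.
exists g; first by rewrite -gE fX polyC_exp /lambda_det /f /= map_polyX.
rewrite -[LHS]/(e g) eg -[e (c _)]/((e \o c) _) ec /e /= map_polyX.
congr (_ * \det (reduced_pencil _ _ _ _ _ _)).
by apply/matrixP => i j; rewrite !mxE /= map_polyC.
Qed.

Lemma theta_formula N H (A0 := coef_mx 0 H) : X%:F *: N = map_mx tf H ->
  theta (\rank A0) N = (\det (col_ebase A0) * \det (row_ebase A0))%:P *
    \det (reduced_pencil (\rank A0) polyC 'X (col_ebase A0) (row_ebase A0)
             (map_mx polyC (coef_mx 1 H))).
Proof.
move=> NH; have := theta_numerator (rank_leq_row A0) (col_ebase_unit A0)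
  (row_ebase_unit A0) NH (esym (mulmx_ebase A0)).
by case=> g /thetaE -> ->.
Qed.

(** This makes [theta] insensitive to perturbations of [x^(p-1) A] that vanish
    at [x = 0]. *)
Lemma theta_congr N N' H H' :
    X%:F *: N = map_mx tf H -> X%:F *: N' = map_mx tf H' ->
    coef_mx 0 H = coef_mx 0 H' -> coef_mx 1 H = coef_mx 1 H' ->
  theta (\rank (coef_mx 0 H)) N = theta (\rank (coef_mx 0 H)) N'.
Proof.
by move=> NH NH' e0 e1; rewrite (theta_formula NH) e0 e1 -(theta_formula NH').
Qed.

(** The pole of the determinant has order at most the rank of the residue of
    [N]. *)
Lemma theta_eq0 r N H : X%:F *: N = map_mx tf H ->
  (\rank (coef_mx 0 H) < r)%N -> theta r N = 0.
Proof.
move=> NH; set A0 := coef_mx 0 H => lt_r.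
have := theta_numerator (rank_leq_row A0) (col_ebase_unit A0)
  (row_ebase_unit A0) NH (esym (mulmx_ebase A0)).
case=> g gE _; rewrite (@thetaE _ _ ((X ^+ (r - \rank A0))%:P * g)).
  rewrite rmorphM /= map_polyC /= rmorphXn /=.
  by rewrite expr0n subn_eq0 leqNgt lt_r mul0r.
rewrite rmorphM /= map_polyC /= -gE mulrA -polyCM tofracXn -exprD subnK //.
exact: ltnW.
Qed.

End Theta.

(** * Necessity of the vanishing of theta *)

Lemma log_quotient (L : fieldType) (u v s t : L) : v != 0 ->
  u * s = u / v * (s - t) * v + u / v * (v * t).
Proof. by move=> v0; field. Qed.

Lemma unitmx_factor (L : comUnitRingType) n (P D Q : 'M[L]_n) :
  P *m D *m Q \in unitmx -> D \in unitmx.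
Proof. by rewrite !unitmx_mul => /andP[/andP[]]. Qed.

Lemma rank_conj (L : fieldType) n (P M Q : 'M[L]_n) :
  Q \in unitmx -> P \in unitmx -> \rank (P *m M *m Q) = \rank M.
Proof.
move=> UQ UP; rewrite mxrankMfree ?row_free_unit // -mxrank_tr trmx_mul.
by rewrite mxrankMfree ?mxrank_tr // row_free_unit unitmx_tr.
Qed.

Section LaurentEuler.
Variable F : fieldType.

Local Notation tf := (@FracField.tofrac {fps F}).
Local Notation X := (fpsX : {fps F}).

Definition laurent_euler (f : {laurent F}) : {laurent F} :=
  X%:F * frac_deriv (@fps_deriv F) f.

Let dfD : {morph @frac_deriv {fps F} (@fps_deriv F) : f g / f + g}.
Proof. exact: (frac_derivD (@fps_derivD F) (@fps_derivM F)). Qed.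
Let dfM f g : frac_deriv (@fps_deriv F) (f * g) =
  frac_deriv (@fps_deriv F) f * g + f * frac_deriv (@fps_deriv F) g.
Proof. exact: (frac_derivM (@fps_derivM F)). Qed.
Let df_tofrac a : frac_deriv (@fps_deriv F) a%:F = (fps_deriv a)%:F.
Proof. exact: (frac_deriv_tofrac (@fps_derivM F)). Qed.

Lemma laurent_eulerD : {morph laurent_euler : f g / f + g}.
Proof. by move=> f g; rewrite /laurent_euler dfD mulrDr. Qed.

Lemma laurent_eulerM f g :
  laurent_euler (f * g) = laurent_euler f * g + f * laurent_euler g.
Proof. by rewrite /laurent_euler dfM mulrDr mulrA (mulrCA _ f). Qed.

Lemma laurent_euler_tofrac a : laurent_euler a%:F = (X * fps_deriv a)%:F.
Proof. by rewrite /laurent_euler df_tofrac tofracM. Qed.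

(** A nonzero Laurent series has a logarithmic derivative without pole: that of
    [x^m] is the constant [m], that of a unit vanishes at [x = 0]. *)
Lemma euler_log f : f != 0 -> exists a : {fps F}, laurent_euler f = f * a%:F.
Proof.
have logS (b : {fps F}) : b != 0 ->
    exists a : {fps F}, laurent_euler b%:F = b%:F * a%:F.
  case/fps_factorX=> m [u [Uu ->]]; exists (m%:R + X * fps_deriv u * u^-1).
  rewrite laurent_euler_tofrac -tofracM; congr (_ %:F).
  have dXm : X * fps_deriv (X ^+ m) = m%:R * X ^+ m.
    elim: m => [|m IHm]; first by rewrite expr0 fps_derivC mulr0 mul0r.
    rewrite exprS fps_derivM mulrDr mulrCA IHm.
    have -> : fps_deriv X = 1.
      by apply/fpsP => -[|i] //=; rewrite mul0rn.
    by rewrite -natr1; ring.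
  have uK : u * u^-1 = 1 by apply: mulrV.
  rewrite fps_derivM mulrDr mulrA dXm !mulrDr.
  by congr (_ + _); [ring | rewrite -[LHS]mulr1 -uK; ring].
move=> f0; have [a [b [b0 fE]]] := fracP f.
have a0 : a != 0 by apply: contra_neq f0 => a0; rewrite fE a0 tofrac0 mul0r.
have [a' aE] := logS a a0; have [b' bE] := logS b b0.
exists (a' - b'); have bF0 : b%:F != 0 by rewrite tofrac_eq0.
apply: (mulIf bF0); apply: (addIr (f * laurent_euler b%:F)).
rewrite -laurent_eulerM fE divfK // aE bE tofracB.
exact: log_quotient.
Qed.

Variable n : nat.
Implicit Types (A T : 'M[{laurent F}]_n) (H P : 'M[{fps F}]_n).

Local Notation gaugex := (gauge laurent_euler).

Lemma map_tofracXn m H : map_mx tf (X ^+ m *: H) = X%:F ^+ m *: map_mx tf H.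
Proof. by rewrite map_mxZ /= tofracXn. Qed.

Lemma unitmx_coef0 P : P \in unitmx -> coef_mx 0 P \in unitmx.
Proof. by case/(map_unitmx_inv (@fps_coef0 F)). Qed.

Lemma euler_log_unitmx P (P' := map_mx tf P) : P \in unitmx ->
  invmx P' *m map_mx laurent_euler P' =
    map_mx tf (X *: (invmx P *m map_mx (@fps_deriv F) P)).
Proof.
move=> UP; have [_ ->] := map_unitmx_inv tf UP.
have -> : map_mx laurent_euler P' = map_mx tf (X *: map_mx (@fps_deriv F) P).
  by apply/matrixP => i j; rewrite !mxE laurent_euler_tofrac.
by rewrite -map_mxM scalemxAr.
Qed.

Lemma euler_log_diag (d : 'rV[{laurent F}]_n) (D := diag_mx d) :
  D \in unitmx -> exists H, invmx D *m map_mx laurent_euler D = map_mx tf H.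
Proof.
move=> UD; have d0 i : d 0 i != 0.
  apply: contraTneq UD => di0; rewrite unitmxE det_diag.
  by rewrite (bigD1 i) //= di0 mul0r unitr0.
have ex i := euler_log (d0 i).
pose a i := projT1 (cid (ex i)).
have aP i : laurent_euler (d 0 i) = d 0 i * (a i)%:F := projT2 (cid (ex i)).
exists (diag_mx (\row_i a i)); rewrite map_diag_mx.
suff -> : map_mx laurent_euler D = D *m diag_mx (map_mx tf (\row_i a i)).
  by rewrite mulKmx.
apply/matrixP => i j; rewrite mul_diag_mx !mxE.
case: eqP => [->|_]; first by rewrite !mulr1n aP.
rewrite !mulr0n mulr0 (derivation0 laurent_eulerD) //.
Qed.

(** The elementary divisors of [T] are nonzero Laurent series, whence the
    logarithmic derivative of the diagonal factor has no pole. *)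
Lemma laurent_smith T : T \in unitmx ->
  exists (P Q : 'M[{fps F}]_n) (D : 'M[{laurent F}]_n) (H : 'M[{fps F}]_n),
    [/\ P \in unitmx, Q \in unitmx, D \in unitmx,
        invmx D *m map_mx laurent_euler D = map_mx tf H
      & T = map_mx tf P *m D *m map_mx tf Q].
Proof.
move=> UT; have [c [T' [c0 cT]]] := common_denominator T.
have [P [d [Q [UP UQ T'E]]]] := fps_smith T'.
have cF0 : c%:F != 0 :> {laurent F} by rewrite tofrac_eq0.
have TPQ : T = map_mx tf P *m diag_mx (c%:F^-1 *: map_mx tf d) *m map_mx tf Q.
  rewrite linearZ /= -map_diag_mx -scalemxAr -scalemxAl -!map_mxM -T'E -cT.
  by rewrite scalerA mulVf // scale1r.
have UD : diag_mx (c%:F^-1 *: map_mx tf d) \in unitmx.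
  by have := UT; rewrite TPQ => /unitmx_factor.
have [H HE] := euler_log_diag UD.
by exists P, Q, (diag_mx (c%:F^-1 *: map_mx tf d)), H.
Qed.

(** In the factorization [T = P D Q], the logarithmic derivative of [P] vanishes at
    [x = 0], so that [P] changes [x^(p-1) A] by a conjugation and a matrix vanishing
    at [x = 0], which [theta] ignores.  The factors [D] and [Q] change it by a
    conjugation and a matrix without pole; that may alter [theta], but not the fact
    that it vanishes once the residue has rank less than [r]. *)
Lemma theta_gauge_eq0 p r A T (Ahat Atil : 'M[{fps F}]_n) :
    (0 < p)%N -> X%:F ^+ p *: A = map_mx tf Ahat ->
    \rank (coef_mx 0 Ahat) = r -> T \in unitmx ->
    X%:F ^+ p *: gaugex T A = map_mx tf Atil ->
    (\rank (coef_mx 0 Atil) < r)%N ->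
  theta r (X%:F ^+ p.-1 *: A) = 0.
Proof.
case: p => // p _ AE rA UT TE lt_r /=.
have dD := laurent_eulerD; have dM := laurent_eulerM.
have [P [Q [D [e2 [UP UQ UD e2E TPQ]]]]] := laurent_smith UT.
have [UP' P'V] := map_unitmx_inv tf UP; have [UQ' Q'V] := map_unitmx_inv tf UQ.
have logP := euler_log_unitmx UP; have logQ := euler_log_unitmx UQ.
have P'A : map_mx tf (invmx P *m Ahat *m P) =
    invmx (map_mx tf P) *m (X%:F ^+ p.+1 *: A) *m map_mx tf P.
  by rewrite AE P'V -!map_mxM.
have Q'e2 : invmx (map_mx tf Q) *m map_mx tf e2 *m map_mx tf Q =
    map_mx tf (invmx Q *m e2 *m Q).
  by rewrite Q'V -!map_mxM.
(* From now on the two unimodular factors only matter through these equations. *)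
move: (map_mx tf P) (map_mx tf Q) TPQ UP' UQ' logP logQ P'A Q'e2 {P'V Q'V}.
move=> P' Q' TPQ UP' UQ' logP logQ P'A Q'e2.
have [G [PAP chiA chiG]] :=
  gauge_lambda_det dD dM (X%:F ^+ p) A UP' UQ' UD logP e2E logQ TPQ.
set e1 := invmx P *m map_mx _ P in PAP chiA.
have /esym e4E := map_mxD tf (X *: (invmx Q *m map_mx (@fps_deriv F) Q))
  (invmx Q *m e2 *m Q).
rewrite Q'e2 e4E in chiG.
set e4 := _ + invmx Q *m e2 *m Q in chiG.
clearbody e1 e4 => {e4E}.
pose AP := invmx P *m Ahat *m P.
have rAP : \rank (coef_mx 0 AP) = r.
  rewrite /AP !coef_mx0M -rA; apply: rank_conj; first exact: unitmx_coef0.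
  by apply: unitmx_coef0; rewrite unitmx_inv.
have E1 : X%:F *: (X%:F ^+ p *: (G + map_mx tf (X *: e1))) = map_mx tf AP.
  by rewrite -PAP P'A exprS -scalerA -[in RHS]scalemxAr -[in RHS]scalemxAl.
have E2 : X%:F *: (X%:F ^+ p *: G) = map_mx tf (AP + X ^+ p.+2 *: - e1).
  rewrite scalerN map_mxB -E1 map_tofracXn !scalerDr -[X *: e1]/(X ^+ 1 *: e1).
  by rewrite map_tofracXn !scalerA -!exprS -exprD addn1 addrK.
have thetaA : theta r (X%:F ^+ p *: A) =
    theta r (X%:F ^+ p *: (G + map_mx tf (X *: e1))).
  by rewrite /theta chiA.
have thetaG : theta r (X%:F ^+ p *: (G + map_mx tf (X *: e1))) =
    theta r (X%:F ^+ p *: G).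
  by rewrite -rAP; apply: (theta_congr E1 E2); symmetry; apply: coef_mxDXn.
have thetaC : theta r (X%:F ^+ p *: G) =
    theta r (X%:F ^+ p *: (gaugex T A + map_mx tf e4)).
  rewrite /theta chiG; reflexivity.
rewrite thetaA thetaG thetaC.
apply: (@theta_eq0 _ _ _ _ (Atil + X ^+ p.+1 *: e4)).
  by rewrite scalerA -exprS scalerDr TE map_mxD map_tofracXn.
by rewrite (coef_mxDXn Atil e4 (ltn0Sn p)).
Qed.

End LaurentEuler.

(** * Deflating subspaces of a singular pencil *)

Section Deflating.
Variables (F : fieldType) (n : nat) (a0 a1 : 'M[F]_n).

(** The pencil [lambda + a1], seen as a map from the kernel of [a0] to its cokernel,
    sends such a [V] into the image of [V] in the cokernel, for every lambda.  If
    [V] meets the row space of [a0], that image has smaller dimension than [V], and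
    the pencil is singular. *)
Definition deflating m (V : 'M[F]_(m, n)) :=
  (V <= kermx a0)%MS && (V *m a1 <= V + a0)%MS.

Lemma deflating_adds m1 m2 (V1 : 'M[F]_(m1, n)) (V2 : 'M[F]_(m2, n)) :
  deflating V1 -> deflating V2 -> deflating (V1 + V2)%MS.
Proof.
case/andP=> k1 d1 /andP[k2 d2]; rewrite /deflating addsmx_sub k1 k2 /=.
rewrite addsmxMr addsmx_sub; apply/andP; split.
  by apply: submx_trans d1 _; rewrite addsmxS ?addsmxSl.
by apply: submx_trans d2 _; rewrite addsmxS ?addsmxSr.
Qed.

(** Deflating subspaces are closed under sums, so one of maximal rank contains
    all the others. *)
Lemma max_deflating :
  exists2 W : 'M[F]_n, deflating W
  & forall m (V : 'M[F]_(m, n)), deflating V -> (V <= W)%MS.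
Proof.
have def0 : deflating (0 : 'M_n) by rewrite /deflating sub0mx mul0mx sub0mx.
pose P k := `[< exists2 W : 'M[F]_n, deflating W & \rank W = k >].
have exP : exists k, P k.
  by exists (\rank (0 : 'M[F]_n)); apply/asboolP; exists 0.
have leP k : P k -> (k <= n)%N.
  by case/asboolP=> W _ <-; apply: rank_leq_row.
case: (ex_maxnP exP leP) => _ /asboolP[W defW <-] maxW; exists W => // m V defV.
have sWV : (W <= W + V)%MS by apply: addsmxSl.
have : (\rank (W + V)%MS <= \rank W)%N.
  by apply: maxW; apply/asboolP; exists (W + V)%MS; rewrite ?deflating_adds.
by rewrite (geq_leqif (mxrank_leqif_sup sWV)) addsmx_sub => /andP[].
Qed.

Definition row_coef i (v : 'rV[{poly F}]_n) : 'rV[F]_n := \row_j (v 0 j)`_i.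

Lemma row_coef_mulC i v (M : 'M[F]_n) :
  row_coef i (v *m map_mx polyC M) = row_coef i v *m M.
Proof.
apply/rowP => j; rewrite !mxE coef_sum; apply: eq_bigr => l _.
by rewrite !mxE coefMC.
Qed.

Lemma row_coef_pencil i v (M : 'M[F]_n) :
  row_coef i (v *m ('X%:M + map_mx polyC M)) =
  (if i is j.+1 then row_coef j v else 0) + row_coef i v *m M.
Proof.
rewrite mulmxDr -row_coef_mulC mul_mx_scalar; apply/rowP => j.
by rewrite !mxE coefD coefXM; case: i => [|i]; rewrite /= !mxE.
Qed.

Lemma row_coef_neq0 (v : 'rV[{poly F}]_n) : v != 0 -> exists i, row_coef i v != 0.
Proof.
move=> v0; apply: contrapT => /forallNP h; case/eqP: v0; apply/rowP => j.
apply/polyP => i; rewrite mxE coef0; have := h i; move/negP; rewrite negbK.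
by move/eqP/rowP/(_ j); rewrite !mxE.
Qed.

Lemma row_coef_big (v : 'rV[{poly F}]_n) i :
  (\sum_j size (v 0%R j) <= i)%N -> row_coef i v = 0.
Proof.
move=> le_i; apply/rowP => j; rewrite !mxE nth_default //.
by apply: leq_trans le_i; rewrite (bigD1 j) //= leq_addr.
Qed.

(** Comparing coefficients, [v_(i-1) + v_i a1 = w_i a0]: each [v_i a1] lies in the
    span of the others up to the row space of [a0], and the equation after the last
    nonzero [v_m] reads [v_m = w_(m+1) a0]. *)
Lemma deflating_poly (v w : 'rV[{poly F}]_n) : v != 0 ->
    v *m map_mx polyC a0 = 0 ->
    v *m ('X%:M + map_mx polyC a1) = w *m map_mx polyC a0 ->
  exists m (V : 'M[F]_(m, n)), deflating V /\ (V :&: a0)%MS != 0.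
Proof.
move=> v0 va0 va1.
have exm := row_coef_neq0 v0.
have lem i : row_coef i v != 0 -> (i <= \sum_j size (v 0%R j))%N.
  by apply: contraR; rewrite -ltnNge => /ltnW/row_coef_big/eqP.
have [m vm0 max_m] := ex_maxnP exm lem.
have vm1 : row_coef m.+1 v = 0.
  by apply/eqP/negPn/negP => /max_m; rewrite ltnn.
pose V := \matrix_(i < m.+1) row_coef i v.
have rV (i : 'I_m.+1) : row i V = row_coef i v by apply: rowK.
have inV i : (i < m.+1)%N -> (row_coef i v <= V)%MS.
  by move=> lt_i; rewrite -(rV (Ordinal lt_i)) row_sub.
have coef_eq i : (if i is j.+1 then row_coef j v else 0) + row_coef i v *m a1
    = row_coef i w *m a0.
  by rewrite -row_coef_pencil va1 row_coef_mulC.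
exists m.+1, V; split.
  rewrite /deflating; apply/andP; split; apply/row_subP => i.
    rewrite rV; apply/sub_kermxP; rewrite -row_coef_mulC va0.
    by apply/rowP => j; rewrite !mxE coef0.
  rewrite row_mul rV; have := coef_eq i; move/(canRL (addKr _)) => ->.
  apply: addmx_sub; last by apply: submx_trans (addsmxSr _ _); apply: submxMl.
  apply: submx_trans (addsmxSl _ _); rewrite eqmx_opp.
  case: i => -[|i] lt_i /=; first exact: sub0mx.
  exact/inV/ltnW.
apply: contraNneq vm0 => V0; rewrite -submx0 -V0 sub_capmx inV //=.
by have := coef_eq m.+1; rewrite vm1 mul0mx addr0 => ->; apply: submxMl.
Qed.

(** A null vector [z] of the reduced pencil yields the polynomial vectors
    [v = z (1 - diag(I_r, 0)) L^-1] and [w = - z L^-1] of [deflating_poly]. *)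
Lemma deflating_of_det0 r (L R : 'M[F]_n) : (r <= n)%N ->
    L \in unitmx -> R \in unitmx -> a0 = L *m pid_mx r *m R ->
    \det (reduced_pencil r polyC 'X L R (map_mx polyC a1)) = 0 ->
  exists m (V : 'M[F]_(m, n)), deflating V /\ (V :&: a0)%MS != 0.
Proof.
move=> le_rn UL UR a0E /eqP/det0P[z z0]; rewrite /reduced_pencil.
have Cinv (M : 'M[F]_n) : M \in unitmx ->
    map_mx polyC (invmx M) *m map_mx polyC M = 1%:M :> 'M[{poly F}]_n.
  by move=> UM; rewrite -map_mxM mulVmx // map_mx1.
have a0E' := congr1 (map_mx polyC) a0E; rewrite !map_mxM map_pid_mx in a0E'.
move: (Cinv L UL) (Cinv R UR) => {Cinv}.
move: (map_mx polyC (invmx L)) (map_mx polyC L) (map_mx polyC (invmx R))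
  (map_mx polyC R) a0E' => Li L' Ri R' a0E' LiL RiR.
rewrite mulmxDr => /eqP; rewrite addr_eq0 => /eqP zE.
have cp := @mul_copid_mx_pid {poly F} n n r le_rn.
apply: (@deflating_poly (z *m copid_mx r *m Li) (- (z *m Li))).
- apply: contra_neq z0 => zc0.
  have z1 : z = z *m pid_mx r + z *m copid_mx r.
    by rewrite -mulmxDr addrC subrK mulmx1.
  have zc : z *m copid_mx r = 0.
    by rewrite -[LHS]mulmx1 -LiL mulmxA zc0 mul0mx.
  by rewrite z1 zE zc addr0 mulmxA zc mul0mx oppr0.
- by rewrite a0E' !mulmxA -(mulmxA _ Li) LiL mulmx1 -(mulmxA z) cp mulmx0 mul0mx.
rewrite a0E' mulNmx !mulmxA -(mulmxA z Li) LiL mulmx1 -mulNmx zE opprK.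
by rewrite -!mulmxA RiR mulmx1.
Qed.

End Deflating.

(** * Invariance under a commuting derivation *)

Section DeflatingDerivation.
Variables (O : idomainType) (d : O -> O).
Hypothesis dD : {morph d : u v / u + v}.
Hypothesis dM : forall u v, d (u * v) = d u * v + u * d v.
Variables (n : nat) (a0 a1 b0 b1 : 'M[O]_n).
Hypothesis comm0 : a0 *m b0 = map_mx d a0 + b0 *m a0.
Hypothesis comm1 :
  a1 *m b0 + a0 *m b1 = map_mx d a1 + b1 *m a0 + b0 *m a1.

Local Notation tf := (@FracField.tofrac O).

(** For [b0] the transpose of the coefficient of [x^0] in [y^q B] and
    [d = y^(q+1) d/dy], this is the action of the second equation of the system, up
    to the factor [y^q], on the rows at [x = 0]. *)
Definition connection m (V : 'M[O]_(m, n)) := V *m b0 - map_mx d V.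

Lemma tofrac_mx_inj m k (M N : 'M[O]_(m, k)) : map_mx tf M = map_mx tf N -> M = N.
Proof.
move=> MN; apply/matrixP => i j; have /matrixP/(_ i j) := MN.
by rewrite !mxE => /eqP; rewrite tofrac_eq => /eqP.
Qed.

(** By [comm0], the connection preserves the kernel and the row space of [a0]; by
    [comm1], it commutes with the map from the kernel to the cokernel which [a1]
    induces. *)
Lemma connection_deflating m (V : 'M[O]_(m, n)) :
    deflating (map_mx tf a0) (map_mx tf a1) (map_mx tf V) ->
  deflating (map_mx tf a0) (map_mx tf a1)
    (col_mx (map_mx tf V) (map_mx tf (connection V))).
Proof.
case/andP=> /sub_kermxP; rewrite -map_mxM => Va0 Va1.
have {}Va0 : V *m a0 = 0 by apply: tofrac_mx_inj; rewrite Va0 map_mx0.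
have dVa0 : map_mx d V *m a0 = - (V *m map_mx d a0).
  apply/eqP; rewrite -addr_eq0 -(derivation_mulmx dD dM) Va0; apply/eqP/matrixP.
  by move=> i j; rewrite !mxE (derivation0 dD).
have dVa1 : connection V *m a1 = connection (V *m a1) - V *m b1 *m a0.
  rewrite /connection mulmxBl (derivation_mulmx dD dM) -!mulmxA.
  have : V *m (a1 *m b0 + a0 *m b1) = V *m (map_mx d a1 + b1 *m a0 + b0 *m a1).
    by rewrite comm1.
  rewrite !mulmxDr (mulmxA V a0) Va0 mul0mx addr0 => ->.
  move: (V *m _) (V *m _) (V *m _) (map_mx d V *m a1) => M1 M2 M3 M4.
  by apply/matrixP => i j; rewrite !mxE; ring.
have /sub_addsmxP[[X Y] /= Va1E] := Va1.
(* The coefficients are made integral, because [d] only acts on [O]. *)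
have [c [XY [c0 cXY]]] := common_denominator (row_mx X Y).
pose X' := lsubmx XY; pose Y' := rsubmx XY.
have cX : c%:F *: X = map_mx tf X'.
  by rewrite map_lsubmx -cXY linearZ /= row_mxKl.
have cY : c%:F *: Y = map_mx tf Y'.
  by rewrite map_rsubmx -cXY linearZ /= row_mxKr.
have cVa1 : c *: (V *m a1) = X' *m V + Y' *m a0.
  apply: tofrac_mx_inj; rewrite map_mxZ map_mxM Va1E scalerDr.
  by rewrite !scalemxAl cX cY map_mxD !map_mxM.
have ccon : c *: connection (V *m a1) = X' *m connection V
    + (Y' *m b0 - map_mx d Y') *m a0 + d c *: (V *m a1) - map_mx d X' *m V.
  have := congr1 (map_mx d) cVa1.
  rewrite (derivation_scalemx dM) (derivation_addmx dD) !(derivation_mulmx dD dM).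
  rewrite -(derivation_mulmx dD dM V a1) => dcVa1.
  have cVa1b0 := congr1 (mulmx^~ b0) cVa1; rewrite /= mulmxDl in cVa1b0.
  rewrite /connection scalerBr (scalemxAl c) cVa1b0 !mulmxBr !mulmxBl -!mulmxA comm0.
  rewrite !mulmxDr; move: dcVa1.
  move: (c *: map_mx d _) (d c *: _) => M1 M2.
  move: (X' *m (V *m b0)) (Y' *m map_mx d a0) (Y' *m (b0 *m a0)) => M3 M4 M5.
  move: (map_mx d X' *m V) (X' *m map_mx d V) (map_mx d Y' *m a0).
  move=> M6 M7 M8 /(canRL (addKr _)) ->.
  by apply/matrixP => i j; rewrite !mxE; ring.
set W := col_mx _ _.
have sVW : (map_mx tf V <= W + map_mx tf a0)%MS.
  by apply: submx_trans (addsmxSl _ _); rewrite -addsmxE addsmxSl.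
have sdVW : (map_mx tf (connection V) <= W + map_mx tf a0)%MS.
  by apply: submx_trans (addsmxSl _ _); rewrite -addsmxE addsmxSr.
have sa0W : (map_mx tf a0 <= W + map_mx tf a0)%MS by apply: addsmxSr.
have sub k l (M : 'M[O]_(k, l)) (N : 'M[O]_(l, n)) :
    (map_mx tf N <= W + map_mx tf a0)%MS ->
    (map_mx tf (M *m N) <= W + map_mx tf a0)%MS.
  by rewrite map_mxM; apply: submx_trans; apply: submxMl.
have sVa1W : (map_mx tf (V *m a1) <= W + map_mx tf a0)%MS.
  rewrite map_mxM; apply: submx_trans Va1 _.
  by rewrite addsmx_sub sVW.
rewrite /deflating; apply/andP; split.
  rewrite /W -addsmxE addsmx_sub; apply/andP; split; apply/sub_kermxP.
    by rewrite -map_mxM Va0 map_mx0.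
  rewrite -map_mxM /connection mulmxBl dVa0 opprK -mulmxA -mulmxDr addrC -comm0.
  by rewrite mulmxA Va0 mul0mx map_mx0.
rewrite {1}/W mul_col_mx col_mx_sub -!map_mxM sVa1W /=.
have cF0 : c%:F != 0 by rewrite tofrac_eq0.
rewrite -(eqmx_scale _ cF0) -map_mxZ dVa1 scalerBr ccon !(map_mxB, map_mxD).
rewrite map_mxZ [map_mx tf (c *: _)]map_mxZ.
have subN k (M : 'M_(k, n)) : (M <= W + map_mx tf a0)%MS ->
    (- M <= W + map_mx tf a0)%MS by rewrite eqmx_opp.
by rewrite !addmx_sub ?subN ?scalemx_sub ?sVa1W ?sub.
Qed.

End DeflatingDerivation.

Section SaturatedBasis.
Variables (F : fieldType) (n : nat).

Local Notation tf := (@FracField.tofrac {fps F}).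

Definition indicator_mx (R : nzRingType) (J : pred 'I_n) : 'M[R]_n :=
  diag_mx (\row_i (J i)%:R).

Lemma map_indicator_mx (R S : nzRingType) (f : {rmorphism R -> S}) J :
  map_mx f (indicator_mx R J) = indicator_mx S J.
Proof.
by rewrite map_diag_mx; congr diag_mx; apply/rowP => i; rewrite !mxE rmorph_nat.
Qed.

(** A subspace over the fraction field meets the lattice of integral rows in a
    saturated submodule, hence in a direct factor.  The Smith form of a matrix
    spanning the subspace exhibits an adapted basis of the lattice: the rows of [Q]
    facing the nonzero elementary divisors. *)
Lemma saturated_basis (W : 'M[{fraction {fps F}}]_n) :
  exists (Q : 'M[{fps F}]_n) (J : pred 'I_n), Q \in unitmx /\
    (W :=: indicator_mx _ J *m map_mx tf Q)%MS.
Proof.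
have [c [M [c0 cW]]] := common_denominator W.
have [P [d [Q [UP UQ ME]]]] := fps_smith M.
exists Q, (fun i => d 0 i != 0); split=> //.
have cF0 : c%:F != 0 by rewrite tofrac_eq0.
have [UP' _] := map_unitmx_inv tf UP.
apply: eqmx_trans (eqmx_sym (eqmx_scale W cF0)) _.
rewrite cW ME -mulmxA map_mxM.
apply: eqmx_trans (eqmxMfull _ _) _; first by rewrite row_full_unit.
rewrite map_mxM; move: (map_mx tf Q) => Q'.
rewrite map_diag_mx; set D := diag_mx _.
have DE : D = D *m indicator_mx _ (fun i => d 0 i != 0).
  rewrite mulmx_diag; congr diag_mx; apply/rowP => i; rewrite !mxE.
  by have [->|_] := eqVneq (d 0 i) 0; rewrite ?tofrac0 ?mul0r ?mulr1.
have ED : indicator_mx _ (fun i => d 0 i != 0) =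
    diag_mx (\row_i (d 0 i)%:F^-1) *m D.
  rewrite mulmx_diag; congr diag_mx; apply/rowP => i; rewrite !mxE.
  have [->|di0] := eqVneq (d 0 i) 0; first by rewrite tofrac0 invr0 mul0r.
  by rewrite mulVf ?tofrac_eq0.
apply/eqmxP/andP; split.
  by rewrite DE -mulmxA submxMl.
by rewrite ED -mulmxA submxMl.
Qed.

End SaturatedBasis.

(** * The reducing shearing *)

Section Indicators.
Variables (R : nzRingType) (n : nat) (J : pred 'I_n).

Let e := indicator_mx R J.
Let f := indicator_mx R (predC J).

Lemma indicator_mulC : e *m f = 0.
Proof.
rewrite mulmx_diag; apply/matrixP => i j; rewrite !mxE /=.
by case: (J i); rewrite ?mulr0 ?mul0r mul0rn.
Qed.

Lemma indicatorC_mul : f *m e = 0.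
Proof.
rewrite mulmx_diag; apply/matrixP => i j; rewrite !mxE /=.
by case: (J i); rewrite ?mulr0 ?mul0r mul0rn.
Qed.

Lemma indicator_idem : e *m e = e.
Proof.
rewrite mulmx_diag; congr diag_mx; apply/rowP => i; rewrite !mxE.
by case: (J i); rewrite ?mulr0 ?mulr1.
Qed.

Lemma indicator_addC : e + f = 1%:M.
Proof.
apply/matrixP => i j; rewrite !mxE /= -mulrnDl.
by case: (J i) => /=; rewrite ?addr0 ?add0r.
Qed.

Lemma tr_indicator : e^T = e.
Proof. exact: tr_diag_mx. Qed.

End Indicators.

Lemma derivation_indicator (O : comNzRingType) (d : O -> O) n (J : pred 'I_n) :
    {morph d : u v / u + v} -> (forall u v, d (u * v) = d u * v + u * d v) ->
  map_mx d (indicator_mx O J) = 0.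
Proof.
move=> dD dM; apply/matrixP => i j; rewrite !mxE.
case: (_ == _); rewrite ?(derivation0 dD) //.
by case: (J i); rewrite ?(derivation0 dD) ?(derivation1 dM).
Qed.

Lemma map_shear_lead (R S : comUnitRingType) (g : {rmorphism R -> S}) n
    (Q a0 a1 e f : 'M[R]_n) : Q \in unitmx ->
  map_mx g (f *m (Q *m a0 *m invmx Q) *m f + e *m (Q *m a1 *m invmx Q) *m f) =
  map_mx g f *m (map_mx g Q *m map_mx g a0 *m invmx (map_mx g Q)) *m map_mx g f
  + map_mx g e *m (map_mx g Q *m map_mx g a1 *m invmx (map_mx g Q)) *m map_mx g f.
Proof. by case/(map_unitmx_inv g)=> _ ->; rewrite map_mxD !map_mxM. Qed.

Lemma shear_lead_tr (A : comNzRingType) n (e f N0 N1 m0 m1 M : 'M[A]_n) :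
    e^T = e -> f^T = f -> N0 = m0^T -> N1 = m1^T -> N0 *m e = 0 ->
    M = e *m N0 *m e + f *m N0 *m f + f *m N1 *m e ->
  M^T = f *m m0 *m f + e *m m1 *m f.
Proof.
move=> eT fT -> -> m0e ->; rewrite -(mulmxA e) m0e mulmx0 add0r.
by rewrite linearD /= !trmx_mul !trmxK eT fT !mulmxA.
Qed.

Lemma mulmx_add0A (A : pzRingType) n (V P Q W : 'M[A]_n) :
  V *m (P *m 0 + Q *m W) = V *m Q *m W.
Proof. by rewrite mulmx0 add0r mulmxA. Qed.

Section ShearRank.
Variables (F : fieldType) (n : nat).

(** With [m0] and [m1] the conjugates of [a0] and [a1] by [Q], the matrix
    [f m0 f + e m1 f] is the leading coefficient after the shearing that multiplies
    by [x] the part [f] of the basis.  The hypothesis on [e Q a1] makes it factor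
    through [m0 f], and the projection [f] kills a nonzero vector of the row space
    of [m0], namely one coming from the intersection of [e Q] with [a0]. *)
Lemma shear_rank Q (a0 a1 : 'M[F]_n) e f : Q \in unitmx ->
    e *m f = 0 -> e + f = 1%:M ->
    e *m Q *m a0 = 0 -> (e *m Q *m a1 <= e *m Q + a0)%MS ->
    (e *m Q :&: a0)%MS != 0 ->
  (\rank (f *m (Q *m a0 *m invmx Q) *m f + e *m (Q *m a1 *m invmx Q) *m f)%R
    < \rank a0)%N.
Proof.
move=> UQ ef ef1 ea0 /sub_addsmxP[[X Y] /= ea1] cap0.
have fa0 : f *m (Q *m a0) = Q *m a0.
  by rewrite -[RHS]mul1mx -ef1 mulmxDl (mulmxA e) ea0 add0r.
pose g := invmx Q *m f.
have eQg : e *m Q *m g = 0 by rewrite /g mulmxA mulmxK.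
have -> : f *m (Q *m a0 *m invmx Q) *m f = Q *m (a0 *m g).
  transitivity (f *m (Q *m a0) *m g); first by rewrite /g !mulmxA.
  by rewrite fa0 -mulmxA.
have -> : e *m (Q *m a1 *m invmx Q) *m f = Y *m (a0 *m g).
  transitivity (e *m Q *m a1 *m g); first by rewrite /g !mulmxA.
  by rewrite ea1 mulmxDl -(mulmxA X) -(mulmxA Y) eQg mulmx0 add0r.
rewrite -mulmxDl.
apply: leq_ltn_trans (mxrankM_maxr _ _) _.
rewrite -(mxrank_mul_ker a0 g) -[ltnLHS]addn0 ltn_add2l lt0n mxrank_eq0.
apply: contraNneq cap0 => ker0; rewrite -submx0 -ker0 sub_capmx capmxSr /=.
apply: submx_trans (capmxSl _ _) _; exact/sub_kermxP.
Qed.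

End ShearRank.

Section ReductionBasis.
Variables (F : fieldType) (d : {fps F} -> {fps F}).
Hypothesis dD : {morph d : u v / u + v}.
Hypothesis dM : forall u v, d (u * v) = d u * v + u * d v.
Variables (n : nat) (a0 a1 b0 b1 : 'M[{fps F}]_n).
Hypothesis comm0 : a0 *m b0 = map_mx d a0 + b0 *m a0.
Hypothesis comm1 :
  a1 *m b0 + a0 *m b1 = map_mx d a1 + b1 *m a0 + b0 *m a1.

Local Notation tf := (@FracField.tofrac {fps F}).

(** The basis is adapted to the largest deflating subspace [W].  That [W] contains
    its image under the connection is a consequence of its maximality; a smaller
    deflating subspace meeting the row space of [a0] would lower the rank as well,
    but it need not be stable. *)
Lemma reduction_basis :
    (exists m (V : 'M_(m, n)), deflating (map_mx tf a0) (map_mx tf a1) V /\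
       (V :&: map_mx tf a0)%MS != 0) ->
  exists (Q : 'M[{fps F}]_n) (J : pred 'I_n),
    let e := indicator_mx _ J in let f := indicator_mx _ (predC J) in
    [/\ Q \in unitmx, e *m Q *m a0 = 0,
        e *m ((Q *m b0 - map_mx d Q) *m invmx Q) *m f = 0
      & (\rank (map_mx tf (f *m (Q *m a0 *m invmx Q) *m f
          + e *m (Q *m a1 *m invmx Q) *m f)) < \rank (map_mx tf a0))%N].
Proof.
case=> m [V [defV capV]].
have [W /andP[kerW defW] maxW] := max_deflating (map_mx tf a0) (map_mx tf a1).
have [Q [J [UQ eqW]]] := saturated_basis W.
exists Q, J => e f.
have eF : map_mx tf e = indicator_mx _ J by apply: map_indicator_mx.
have fF : map_mx tf f = indicator_mx _ (predC J) by apply: map_indicator_mx.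
rewrite -eF in eqW.
have [UQ' Q'V] := map_unitmx_inv tf UQ.
have ea0F : map_mx tf e *m map_mx tf Q *m map_mx tf a0 = 0.
  by apply/sub_kermxP; rewrite -eqW.
have ea1F : (map_mx tf e *m map_mx tf Q *m map_mx tf a1 <=
    map_mx tf e *m map_mx tf Q + map_mx tf a0)%MS.
  by rewrite -(eqmxMr _ eqW) (submx_trans defW) // addsmxS // eqW.
have de : map_mx d e = 0 by apply: derivation_indicator.
have ef : e *m f = 0 by apply: indicator_mulC.
have conE : connection d b0 (e *m Q) = e *m (Q *m b0 - map_mx d Q).
  by rewrite /connection (derivation_mulmx dD dM) de mul0mx add0r mulmxBr mulmxA.
have stable : (map_mx tf (connection d b0 (e *m Q)) <=
    map_mx tf e *m map_mx tf Q)%MS.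
  have : deflating (map_mx tf a0) (map_mx tf a1) (map_mx tf (e *m Q)).
    by rewrite map_mxM /deflating ea1F andbT; apply/sub_kermxP.
  move/(connection_deflating dD dM comm0 comm1)/maxW.
  by rewrite col_mx_sub !eqW => /andP[].
have efF : map_mx tf e *m map_mx tf f = 0 by rewrite eF fF indicator_mulC.
have ef1F : map_mx tf e + map_mx tf f = 1%:M by rewrite eF fF indicator_addC.
have capF : (map_mx tf e *m map_mx tf Q :&: map_mx tf a0)%MS != 0.
  apply: contraNneq capV => cap0; rewrite -submx0 -cap0 capmxS // -eqW.
  exact: maxW.
have leadF : map_mx tf (f *m (Q *m a0 *m invmx Q) *m f
      + e *m (Q *m a1 *m invmx Q) *m f) =
    map_mx tf f *m (map_mx tf Q *m map_mx tf a0 *m invmx (map_mx tf Q))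
      *m map_mx tf f
    + map_mx tf e *m (map_mx tf Q *m map_mx tf a1 *m invmx (map_mx tf Q))
      *m map_mx tf f.
  exact: map_shear_lead.
have [Z conZ] := submxP stable; rewrite conE in conZ.
have conF : map_mx tf (e *m ((Q *m b0 - map_mx d Q) *m invmx Q) *m f) = 0.
  rewrite mulmxA map_mxM map_mxM conZ -Q'V.
  move: (map_mx tf Q) (map_mx tf e) (map_mx tf f) UQ' efF => Q' e' f' UQ' efF.
  by rewrite -(mulmxA Z) (mulmxK UQ') -mulmxA efF mulmx0.
split; first exact: UQ.
- by apply: tofrac_mx_inj; rewrite !map_mxM map_mx0.
- by apply: tofrac_mx_inj; rewrite conF map_mx0.
by rewrite leadF; apply: (shear_rank UQ' efF ef1F ea0F ea1F capF).
Qed.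

End ReductionBasis.

Section ShearConjugation.
Variables (A : comNzRingType) (n : nat) (x : A) (E F M N : 'M[A]_n).

Lemma shear_conj : E *m E = E -> E *m F = 0 -> F *m E = 0 -> F *m F = F ->
    E + F = 1%:M -> F *m M *m E = x *: (F *m N) ->
  M *m (E + x *: F) =
    (E + x *: F) *m (E *m M *m E + x *: (E *m M *m F) + F *m M *m F + F *m N).
Proof.
move=> EE EF FE FF EF1 FME.
have splitM (G : 'M_n) : M *m G = E *m M *m G + F *m M *m G.
  by rewrite -!mulmxDl EF1 mul1mx.
rewrite (mulmxDr M) -scalemxAr (splitM E) (splitM F) FME.
rewrite !mulmxDl !mulmxDr -!(scalemxAl, scalemxAr) !mulmxA EE EF FE FF.
rewrite !mul0mx !scaler0.
move: (E *m M *m E) (E *m M *m F) (F *m M *m F) (F *m N) => M1 M2 M3 M4.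
by apply/matrixP => i j; rewrite !mxE; ring.
Qed.

End ShearConjugation.

Section GaugeIntegral.
Variables (A : comUnitRingType) (L : fieldType) (tf : {rmorphism A -> L}).
Variables (dA : A -> A) (dL : L -> L).
Hypothesis dD : {morph dL : u v / u + v}.
Hypothesis dM : forall u v, dL (u * v) = dL u * v + u * dL v.
Hypothesis d_tf : forall u, dL (tf u) = tf (dA u).
Variable n : nat.
Implicit Types (U D H M G : 'M[A]_n).

Let map_d_tf M : map_mx dL (map_mx tf M) = map_mx tf (map_mx dA M).
Proof. by apply/matrixP => i j; rewrite !mxE d_tf. Qed.

Lemma derivation_constV (u : L) : dL u = 0 -> dL u^-1 = 0.
Proof.
have [->|u0] := eqVneq u 0; first by rewrite invr0.
move=> du; apply: (mulfI u0); rewrite mulr0.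
by have := dM u u^-1; rewrite mulfV // (derivation1 dM) du mul0r add0r.
Qed.

Lemma map_derivation_frac (h : A) H : dA h = 0 ->
  map_mx dL ((tf h)^-1 *: map_mx tf H) = (tf h)^-1 *: map_mx tf (map_mx dA H).
Proof.
move=> dh; rewrite (derivation_scalemx dM) derivation_constV ?scale0r ?add0r.
  by rewrite map_d_tf.
by rewrite d_tf dh rmorph0.
Qed.

(** The system [d Y = H/h Y] and its transform by [U D] have the same denominator
    [h] as soon as conjugation by [D] is possible over [A], which is the meaning of
    the two divisibility hypotheses. *)
Lemma gauge_integral (h : A) U D H M G :
    U \in unitmx -> map_mx tf D \in unitmx -> tf h != 0 ->
    invmx U *m (H *m U - h *: map_mx dA U) *m D = D *m M ->
    map_mx dA D = D *m G ->
  tf h *: gauge dL (map_mx tf U *m map_mx tf D) ((tf h)^-1 *: map_mx tf H)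
    = map_mx tf (M - h *: G).
Proof.
move=> UU UD h0 NDM dDG; have [UU' U'V] := map_unitmx_inv tf UU.
rewrite (gaugeM dD dM) //.
set N := invmx U *m _ in NDM.
have -> : gauge dL (map_mx tf U) ((tf h)^-1 *: map_mx tf H) =
    (tf h)^-1 *: map_mx tf N.
  rewrite /gauge map_d_tf U'V /N map_mxM map_mxB map_mxM map_mxZ.
  by rewrite scalemxAr scalerBr scalerA mulVf // scale1r scalemxAl.
rewrite /gauge map_d_tf dDG -scalemxAl -map_mxM NDM !map_mxM (scalemxAr (tf h)^-1).
by rewrite -mulmxBr mulKmx // scalerBr scalerA mulfV // scale1r map_mxB map_mxZ.
Qed.

End GaugeIntegral.

Lemma clear_poles (A : comNzRingType) (L : fieldType) (tf : {rmorphism A -> L})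
    n (h l : A) (P Q M N : 'M[A]_n) :
    injective tf -> tf h != 0 -> tf l != 0 ->
    (tf l)^-1 *: map_mx tf P
      + ((tf l)^-1 *: map_mx tf M) *m ((tf h)^-1 *: map_mx tf N) =
    (tf h)^-1 *: map_mx tf Q
      + ((tf h)^-1 *: map_mx tf N) *m ((tf l)^-1 *: map_mx tf M) ->
  h *: P + M *m N = l *: Q + N *m M.
Proof.
move=> tf_inj; set s := tf h; set t := tf l => s0 t0.
move/(congr1 (fun V => (s * t) *: V)).
rewrite !scalerDr -!scalemxAl -!scalemxAr !scalerA.
rewrite !mulfK // !(mulrAC s t) !mulfV // mul1r !mulfV // !scale1r.
rewrite -!map_mxM -!map_mxZ -!map_mxD => E; apply/matrixP => i j; apply: tf_inj.
by have /matrixP/(_ i j) := E; rewrite [LHS]mxE [RHS]mxE.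
Qed.

Section ShearSeries.
Variables (R : comNzRingType) (n : nat) (J : pred 'I_n).

Let e := indicator_mx R J.
Let f := indicator_mx R (predC J).
Let ec := constant_mx e.
Let fc := constant_mx f.

Definition shear_mx : 'M[{fps R}]_n := ec + fpsX *: fc.

Lemma shear_mx_entry i j : shear_mx i j = fpsC (e i j) + fpsX * fpsC (f i j).
Proof.
rewrite /shear_mx [LHS]mxE; congr (_ + _); first by rewrite mxE.
by rewrite [LHS]mxE; congr (_ * _); rewrite mxE.
Qed.

Lemma shear_mxE : shear_mx = diag_mx (\row_i fpsX ^+ (~~ J i)).
Proof.
apply/matrixP => i j; rewrite !mxE /=; case: (i == j); last first.
  by rewrite !mulr0n !rmorph0 mulr0 addr0.
rewrite !mulr1n; case: (J i) => /=.
  by rewrite rmorph1 rmorph0 mulr0 addr0 expr0.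
by rewrite rmorph0 rmorph1 mulr1 add0r expr1.
Qed.

(** Conjugating by the shearing costs no pole when the block which it divides by
    [x] vanishes at [x = 0]. *)
Lemma shear_series (N : 'M[{fps R}]_n) : f *m coef_mx 0 N *m e = 0 ->
  exists2 M, N *m shear_mx = shear_mx *m M
    & coef_mx 0 M = e *m coef_mx 0 N *m e + f *m coef_mx 0 N *m f
        + f *m coef_mx 1 N *m e.
Proof.
move=> fNe; pose S := map_mx (@fps_shift R) N.
have cM (P Q : 'M[R]_n) : constant_mx (P *m Q) = constant_mx P *m constant_mx Q.
  exact: (map_mxM (@fpsC R)).
exists (ec *m N *m ec + fpsX *: (ec *m N *m fc) + fc *m N *m fc
  + fc *m (S *m ec)).
  apply: shear_conj.
  - by rewrite -cM indicator_idem.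
  - by rewrite -cM indicator_mulC /constant_mx map_mx0.
  - by rewrite -cM indicatorC_mul /constant_mx map_mx0.
  - by rewrite -cM indicator_idem.
  - by rewrite -map_mxD indicator_addC map_mx1.
  rewrite {1}[N]shift_mxE -/S mulmxDr mulmxDl -!cM fNe.
  by rewrite /constant_mx map_mx0 add0r -scalemxAr -scalemxAl mulmxA.
rewrite !coef_mxD coef_mx0Z scale0r addr0 !coef_mx0M !coef_mx0C mulmxA.
congr (_ + _ *m _ *m _).
by apply/matrixP => i j; rewrite !mxE.
Qed.

End ShearSeries.

(** * Moser ranks *)

Section MoserRank.
Variables (k : fieldType) (n : nat).
Implicit Types (M : 'M[{laurent k}]_n) (H : 'M[{fps k}]_n).

Local Notation tf := (@FracField.tofrac {fps k}).
Local Notation X := (fpsX : {fps k}).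

Lemma no_pole_mxP M : no_pole_mx M <-> exists H, M = map_mx tf H.
Proof.
split=> [npM | [H ->] i j]; last by exists (H i j); rewrite mxE.
exists (\matrix_(i, j) projT1 (cid (npM i j))).
by apply/matrixP => i j; rewrite !mxE; case: (cid (npM i j)).
Qed.

Lemma lead_mxE p M H : X%:F ^+ p *: M = map_mx tf H -> lead_mx p M = coef_mx 0 H.
Proof.
by rewrite /lead_mx => ->; apply/matrixP => i j; rewrite !mxE at0_tofrac.
Qed.

Lemma lead_mx_gt m p M : no_pole_mx (X%:F ^+ m *: M) -> (m < p)%N ->
  lead_mx p M = 0.
Proof.
case/no_pole_mxP=> H HE lt_mp.
have pE : X%:F ^+ p *: M = map_mx tf (X ^+ (p - m) *: H).
  by rewrite map_tofracXn -HE scalerA -exprD subnK // ltnW.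
by rewrite (lead_mxE pE) coef_mxXn // subn_gt0.
Qed.

Lemma pole_orderP M : no_pole_mx (X%:F ^+ pole_order M *: M).
Proof. by rewrite /pole_order; case: ex_minnP => m /asboolP. Qed.

Lemma pole_order_le p M : no_pole_mx (X%:F ^+ p *: M) <-> (pole_order M <= p)%N.
Proof.
split=> [npM | le_p i j].
  by rewrite /pole_order; case: ex_minnP => m _; apply; apply/asboolP.
have := no_poleXM (p - pole_order M) (pole_orderP M i j).
by rewrite !mxE mulrA -exprD subnK.
Qed.

Lemma laurent_moser_rankE M :
  laurent_moser_rank M =
    (pole_order M)%:R + (\rank (lead_mx (pole_order M) M))%:R / n%:R.
Proof. by rewrite /laurent_moser_rank max_r // addr_ge0 // divr_ge0. Qed.

Let score_lt (a b c d : nat) : (0 < n)%N ->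
  (a%:R + b%:R / n%:R < c%:R + d%:R / n%:R :> rat) = (a * n + b < c * n + d)%N.
Proof.
move=> n0; have n0' : 0 < n%:R :> rat by rewrite ltr0n.
rewrite -(ltr_pM2r n0') !mulrDl !divfK ?gt_eqF // -!natrM -!natrD.
by rewrite ltr_nat.
Qed.

(** The rank of the leading coefficient being at most [n], Moser ranks compare pole
    orders first. *)
Lemma laurent_moser_rank_lt p r M : (0 < r <= n)%N ->
  laurent_moser_rank M < p%:R + r%:R / n%:R <->
  no_pole_mx (X%:F ^+ p *: M) /\ (\rank (lead_mx p M) < r)%N.
Proof.
case/andP=> r0 le_rn; have n0 : (0 < n)%N by apply: leq_trans le_rn.
rewrite laurent_moser_rankE score_lt //.
have le_s := rank_leq_row (lead_mx (pole_order M) M).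
have [lt_p|lt_p|eq_p] := ltngtP (pole_order M) p.
- rewrite (lead_mx_gt (pole_orderP M) lt_p) mxrank0; split=> _.
    by split=> //; apply/pole_order_le/ltnW.
  by have := leq_mul lt_p (leqnn n); nia.
- split=> [lt_s | [/pole_order_le]]; last by rewrite leqNgt lt_p.
  by have := leq_mul lt_p (leqnn n); nia.
- rewrite eq_p ltn_add2l; split=> [lt_s|[]//]; split=> //.
  by apply/pole_order_le; rewrite eq_p.
Qed.

Lemma laurent_moser_rank_lead p M H : X%:F ^+ p *: M = map_mx tf H ->
    coef_mx 0 H != 0 ->
  laurent_moser_rank M = p%:R + (\rank (coef_mx 0 H))%:R / n%:R.
Proof.
move=> HE H0; rewrite laurent_moser_rankE.
suff -> : pole_order M = p by rewrite (lead_mxE HE).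
apply/eqP; rewrite eqn_leq; apply/andP; split.
  by apply/pole_order_le/no_pole_mxP; exists H.
rewrite leqNgt; apply: contra H0 => lt_p.
by rewrite -(lead_mxE HE) (lead_mx_gt (pole_orderP M) lt_p).
Qed.

End MoserRank.

(** * Power series in two variables *)

Section TwoVariables.
Variable R : realType.

Local Notation O := (Cy R).
Local Notation k := {fraction Cy R}.
Local Notation tfk := (@FracField.tofrac (Cy R)).
Local Notation tfK := (@FracField.tofrac (Cxy R)).
Local Notation tfL := (@FracField.tofrac {fps k}).
Local Notation phi := (fps_map tfk).

Lemma fps_map_tofrac_inj : injective phi.
Proof. by apply: fps_map_inj => u v /eqP; rewrite tofrac_eq => /eqP. Qed.

HB.instance Definition _ :=
  GRing.isZmodMorphism.Build (Kxy R) {laurent k} (@laurent_x R)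
    (frac_map_zmod_morphism fps_map_tofrac_inj).
HB.instance Definition _ :=
  GRing.isMonoidMorphism.Build (Kxy R) {laurent k} (@laurent_x R)
    (frac_map_monoid_morphism fps_map_tofrac_inj).

Lemma laurent_x_tofrac (u : Cxy R) : laurent_x u%:F = (phi u)%:F.
Proof. exact: frac_map_tofrac fps_map_tofrac_inj u. Qed.

Lemma laurent_Kx : laurent_x (Kx R) = fpsX%:F.
Proof.
rewrite /Kx laurent_x_tofrac; congr (_ %:F); apply/fpsP => i /=.
exact: rmorph_nat.
Qed.

Definition euler_x (u : Cxy R) : Cxy R := fpsX * fps_deriv u.
Definition euler_y (u : Cxy R) : Cxy R :=
  fpsC fpsX * fps_map (@fps_deriv (complex R)) u.

Let fps_mapDd : {morph fps_map (@fps_deriv (complex R)) : u v / u + v}.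
Proof. by move=> u v; apply/fpsP => i /=; apply: fps_derivD. Qed.

Let fps_mapMd (u v : Cxy R) :
  fps_map (@fps_deriv (complex R)) (u * v) =
  fps_map (@fps_deriv (complex R)) u * v + u * fps_map (@fps_deriv (complex R)) v.
Proof.
apply/fpsP => i; rewrite fpsDE !fpsME /= -big_split /=.
rewrite (derivation_sum (@fps_derivD (complex R))).
by apply: eq_bigr => j _; apply: fps_derivM.
Qed.

Definition eulerK_x (u : Kxy R) : Kxy R := Kx R * dx u.
Definition eulerK_y (u : Kxy R) : Kxy R := Ky R * dy u.

Lemma eulerK_xD : {morph eulerK_x : u v / u + v}.
Proof.
move=> u v; rewrite /eulerK_x -mulrDr; congr (_ * _).
exact: (frac_derivD (@fps_derivD O) (@fps_derivM O)).
Qed.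

Lemma eulerK_yD : {morph eulerK_y : u v / u + v}.
Proof.
move=> u v; rewrite /eulerK_y -mulrDr; congr (_ * _).
exact: (frac_derivD fps_mapDd fps_mapMd).
Qed.

Lemma eulerK_xM u v : eulerK_x (u * v) = eulerK_x u * v + u * eulerK_x v.
Proof.
have dM : dx (u * v) = dx u * v + u * dx v := frac_derivM (@fps_derivM O) u v.
by rewrite /eulerK_x dM mulrDr mulrA (mulrCA _ u).
Qed.

Lemma eulerK_yM u v : eulerK_y (u * v) = eulerK_y u * v + u * eulerK_y v.
Proof.
have dM : dy (u * v) = dy u * v + u * dy v := frac_derivM fps_mapMd u v.
by rewrite /eulerK_y dM mulrDr mulrA (mulrCA _ u).
Qed.

Lemma eulerK_x_tofrac u : eulerK_x (tfK u) = tfK (euler_x u).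
Proof.
have dE : dx (tfK u) = tfK (fps_deriv u) := frac_deriv_tofrac (@fps_derivM O) u.
by rewrite /eulerK_x dE /Kx -tofracM.
Qed.

Lemma eulerK_y_tofrac u : eulerK_y (tfK u) = tfK (euler_y u).
Proof.
have dE : dy (tfK u) = tfK (fps_map (@fps_deriv (complex R)) u) :=
  frac_deriv_tofrac fps_mapMd u.
by rewrite /eulerK_y dE /Ky -tofracM.
Qed.

Lemma laurent_eulerK u : laurent_x (eulerK_x u) = laurent_euler (laurent_x u).
Proof.
have dE : laurent_x (dx u) = frac_deriv (@fps_deriv k) (laurent_x u).
  apply: (frac_map_deriv u fps_map_tofrac_inj (@fps_derivM O) (@fps_derivM k)) => v.
  by apply/fpsP => i /=; rewrite rmorphMn.
have xE : laurent_x (Kx R * dx u) = laurent_x (Kx R) * laurent_x (dx u).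
  exact: rmorphM.
by rewrite /eulerK_x xE laurent_Kx dE.
Qed.

Variable n : nat.
Implicit Types (A B T : 'M[Kxy R]_n) (H : 'M[Cxy R]_n).

Lemma gauge_xE T A : gauge_x T A = gauge eulerK_x T A.
Proof.
by congr (_ *m (_ - _)); apply/matrixP => i j; rewrite !mxE.
Qed.

Lemma gauge_yE T B : gauge_y T B = gauge eulerK_y T B.
Proof.
by congr (_ *m (_ - _)); apply/matrixP => i j; rewrite !mxE.
Qed.

Lemma laurent_gauge_x T A : map_mx (@laurent_x R) (gauge_x T A) =
  gauge (@laurent_euler k) (map_mx (@laurent_x R) T) (map_mx (@laurent_x R) A).
Proof. by rewrite gauge_xE; apply: map_gauge; apply: laurent_eulerK. Qed.

(** [C[[x,y]]] inside [k[[x]]], [k] being the fraction field of [C[[y]]]. *)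
Definition generic_y H : 'M[{fps k}]_n := map_mx phi H.

Lemma laurent_mx_of_Cxy H :
  map_mx (@laurent_x R) (mx_of_Cxy H) = map_mx tfL (generic_y H).
Proof. by apply/matrixP => i j; rewrite !mxE; apply: laurent_x_tofrac. Qed.

Lemma laurent_scaleKx p A H : Kx R ^+ p *: A = mx_of_Cxy H ->
  fpsX%:F ^+ p *: map_mx (@laurent_x R) A = map_mx tfL (generic_y H).
Proof.
move=> AH; rewrite -laurent_mx_of_Cxy -AH map_mxZ; congr (_ *: _).
by rewrite rmorphXn /= laurent_Kx.
Qed.

Lemma coef_generic_y i H : coef_mx i (generic_y H) = map_mx tfk (xcoef_mx i H).
Proof. by apply/matrixP => a b; rewrite !mxE. Qed.

Lemma euler_x_scale p H : fpsX ^+ p *: map_mx euler_x H =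
  fpsX ^+ p.+1 *: map_mx (@fps_deriv (Cy R)) H.
Proof.
rewrite exprSr -scalerA; congr (_ *: _).
by apply/matrixP => u v; rewrite [LHS]mxE [RHS]mxE [in RHS]mxE.
Qed.

Lemma euler_y_scale q H i : coef_mx i (fpsC fpsX ^+ q *: map_mx euler_y H) =
  map_mx (fun u : Cy R => fpsX ^+ q.+1 * fps_deriv u) (coef_mx i H).
Proof.
apply/matrixP => u v; rewrite !mxE /euler_y -rmorphXn mulrA -rmorphM.
by rewrite fpsCME -exprSr.
Qed.

(** Multiplied by [x^p y^q], the integrability condition has power series
    coefficients, and its term [x dB/dx] is then divisible by [x^(p+1)]: it does not
    enter the orders [0] and [1] in [x] when [p > 0]. *)
Lemma integrability_orders p q A B (Ahat Bhat : 'M[Cxy R]_n)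
    (d := fun u : Cy R => fpsX ^+ q.+1 * fps_deriv u) :
    (0 < p)%N -> normal_crossings_system p q A B Ahat Bhat ->
  let a i := xcoef_mx i Ahat in let b i := xcoef_mx i Bhat in
  [/\ b 0%N *m a 0%N = map_mx d (a 0%N) + a 0%N *m b 0%N
    & b 0%N *m a 1%N + b 1%N *m a 0%N =
        map_mx d (a 1%N) + (a 0%N *m b 1%N + a 1%N *m b 0%N)].
Proof.
move=> p_gt0 [AE BE _ _ intE] a b.
pose h : Cxy R := fpsX ^+ p; pose l : Cxy R := fpsC fpsX ^+ q.
have X0 : fpsX != 0 :> Cxy R by apply: fpsX_neq0.
have Y0 : fpsC fpsX != 0 :> Cxy R.
  by apply/eqP => /fpsP/(_ 0%N)/eqP; rewrite /= (negPf (fpsX_neq0 _)).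
have hK : Kx R ^+ p = tfK h by rewrite [RHS]tofracXn.
have lK : Ky R ^+ q = tfK l by rewrite [RHS]tofracXn.
have h0 : tfK h != 0 by rewrite tofrac_eq0 expf_neq0.
have l0 : tfK l != 0 by rewrite tofrac_eq0 expf_neq0.
have exl : euler_x l = 0.
  rewrite /euler_x /l -rmorphXn /=.
  by rewrite fps_derivC mulr0.
have eyh : euler_y h = 0.
  rewrite /euler_y; have -> : fps_map (@fps_deriv (complex R)) h = 0.
    have X' : fps_map (@fps_deriv (complex R)) fpsX = 0.
      by apply/fpsP => i; apply/fpsP => j /=; case: (i == 1%N); rewrite /= mul0rn.
    rewrite /h; elim: (p) => [|m IHm]; first by rewrite (derivation1 fps_mapMd).
    by rewrite exprS fps_mapMd X' mul0r add0r IHm mulr0.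
  by rewrite mulr0.
have intC : h *: map_mx euler_x Bhat + Bhat *m Ahat =
    l *: map_mx euler_y Ahat + Ahat *m Bhat.
  have eB : Kx R *: map_mx (@dx R) B =
      (tfK l)^-1 *: map_mx tfK (map_mx euler_x Bhat).
    have -> : Kx R *: map_mx (@dx R) B = map_mx eulerK_x B.
      by apply/matrixP => i j; rewrite !mxE.
    rewrite BE lK.
    exact: (map_derivation_frac eulerK_xM eulerK_x_tofrac Bhat exl).
  have eA : Ky R *: map_mx (@dy R) A =
      (tfK h)^-1 *: map_mx tfK (map_mx euler_y Ahat).
    have -> : Ky R *: map_mx (@dy R) A = map_mx eulerK_y A.
      by apply/matrixP => i j; rewrite !mxE.
    rewrite AE hK.
    exact: (map_derivation_frac eulerK_yM eulerK_y_tofrac Ahat eyh).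
  rewrite eB eA BE AE hK lK in intE.
  apply: (clear_poles _ h0 l0 intE) => u v /eqP.
  by rewrite tofrac_eq => /eqP.
have coefx i : (i < p.+1)%N -> coef_mx i (h *: map_mx euler_x Bhat) = 0.
  by move=> lt_i; rewrite euler_x_scale; exact: coef_mxXn.
have lhs i : (i < p.+1)%N -> coef_mx i (Bhat *m Ahat) =
    coef_mx i (h *: map_mx euler_x Bhat + Bhat *m Ahat).
  by move=> lt_i; rewrite coef_mxD (coefx i lt_i) add0r.
have rhs i : coef_mx i (l *: map_mx euler_y Ahat + Ahat *m Bhat) =
    map_mx d (a i) + coef_mx i (Ahat *m Bhat).
  by rewrite coef_mxD euler_y_scale.
have eqn i : (i < p.+1)%N ->
    coef_mx i (Bhat *m Ahat) = map_mx d (a i) + coef_mx i (Ahat *m Bhat).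
  by move=> lt_i; rewrite -(rhs i) -intC; exact: lhs.
have eqn0 := eqn 0%N isT; have eqn1 := eqn 1%N p_gt0.
rewrite !coef_mx0M in eqn0; rewrite !coef_mx1M in eqn1.
split; first exact: eqn0.
exact: eqn1.
Qed.

End TwoVariables.
(** * Shearing a Pfaffian system *)

Lemma euler_x_affine (R : realType) (a b : Cy R) :
  euler_x (fpsC a + fpsX * fpsC b) = fpsX * fpsC b.
Proof.
rewrite /euler_x; congr (_ * _); apply/fpsP => i.
change ((fpsC a + fpsX * fpsC b) i.+1 *+ i.+1 = fpsC b i).
by rewrite fpsDE fpsXME add0r; case: i => [|i] /=; rewrite ?mulr1n ?mul0rn.
Qed.

Lemma euler_y_affine (R : realType) (a b : Cy R) :
  fps_deriv a = 0 -> fps_deriv b = 0 -> euler_y (fpsC a + fpsX * fpsC b) = 0.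
Proof.
move=> da db; have d0 : fps_deriv (0 : Cy R) = 0.
  exact: (derivation0 (@fps_derivD (complex R))).
rewrite /euler_y; have -> : fps_map (@fps_deriv (complex R))
    (fpsC a + fpsX * fpsC b) = 0.
  apply/fpsP => i.
  change (fps_deriv ((fpsC a + fpsX * fpsC b) i) = 0).
  rewrite fpsDE; case: i => [|i]; first by rewrite fpsXM0 addr0.
  by rewrite fpsXME add0r /=; case: eqP.
by rewrite mulr0.
Qed.

Section UnimodularShearing.
Variables (R : realType) (n : nat) (J : pred 'I_n).
Implicit Types (U : 'M[Cy R]_n) (H : 'M[Cxy R]_n).

Local Notation tfK := (@FracField.tofrac (Cxy R)).
Local Notation e := (indicator_mx (Cy R) J).
Local Notation f := (indicator_mx (Cy R) (predC J)).
Local Notation D := (shear_mx (Cy R) J).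

(** The exponent is [0] on [J], which will index a basis of a subspace to be
    preserved at [x = 0], and [1] elsewhere. *)
Definition unimodular_shear U : 'M[Kxy R]_n :=
  mx_of_Cy U *m diag_mx (\row_i Kx R ^+ (~~ J i)).

Lemma map_shear_mx : map_mx tfK D = diag_mx (\row_i Kx R ^+ (~~ J i)).
Proof.
rewrite shear_mxE map_diag_mx; congr diag_mx.
by apply/rowP => i; rewrite !mxE; apply: (rmorphXn tfK).
Qed.

Lemma mx_of_Cy_constant U : mx_of_Cy U = map_mx tfK (constant_mx U).
Proof. by apply/matrixP => i j; rewrite !mxE. Qed.

Lemma unimodular_shearE U :
  unimodular_shear U = map_mx tfK (constant_mx U) *m map_mx tfK D.
Proof. by rewrite map_shear_mx -mx_of_Cy_constant. Qed.

Lemma shear_mx_unit : map_mx tfK D \in unitmx.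
Proof.
rewrite map_shear_mx unitmxE det_diag unitfE; apply/prodf_neq0 => i _.
by rewrite mxE expf_neq0 // tofrac_eq0 fpsX_neq0.
Qed.

Lemma unimodular_shear_unit U : U \in unitmx -> unimodular_shear U \in unitmx.
Proof.
move=> UU; have [UUc _] := map_unitmx_inv (@fpsC (Cy R)) UU.
have [UUK _] := map_unitmx_inv tfK UUc.
by rewrite unimodular_shearE unitmx_mul UUK shear_mx_unit.
Qed.

Lemma unimodular_shearP U : U \in unitmx ->
  unimodular_shearing_product (unimodular_shear U).
Proof.
by move=> UU; apply: USP_mul (USP_unimodular UU) (USP_shearing R (fun i => ~~ J i : nat)).
Qed.

Lemma euler_x_constant m (M : 'M[Cy R]_(m, n)) :
  map_mx (@euler_x R) (constant_mx M) = 0.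
Proof.
by apply/matrixP => i j; rewrite !mxE /euler_x fps_derivC mulr0.
Qed.

Lemma euler_x_shear : map_mx (@euler_x R) D = D *m constant_mx f.
Proof.
have cM (P Q : 'M[Cy R]_n) : constant_mx P *m constant_mx Q = constant_mx (P *m Q).
  exact: esym (map_mxM (@fpsC (Cy R)) P Q).
rewrite /shear_mx mulmxDl -scalemxAl !cM indicator_mulC indicator_idem.
rewrite [constant_mx 0]map_mx0 add0r; apply/matrixP => i j.
rewrite [LHS]mxE shear_mx_entry euler_x_affine [RHS]mxE.
by congr (_ * _); rewrite [RHS]mxE.
Qed.

Lemma euler_y_shear : map_mx (@euler_y R) D = 0.
Proof.
have d0 (J' : pred 'I_n) : map_mx (@fps_deriv (complex R)) (indicator_mx (Cy R) J') = 0.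
  exact: (derivation_indicator J' (@fps_derivD _) (@fps_derivM _)).
apply/matrixP => i j; rewrite [LHS]mxE shear_mx_entry [RHS]mxE; apply: euler_y_affine.
  by have /matrixP/(_ i j) := d0 J; rewrite mxE [RHS]mxE.
by have /matrixP/(_ i j) := d0 (predC J); rewrite mxE [RHS]mxE.
Qed.

Lemma euler_y_constant (U : 'M[Cy R]_n) q :
  coef_mx 0 (fpsC fpsX ^+ q *: map_mx (@euler_y R) (constant_mx U)) =
    map_mx (fun u : Cy R => fpsX ^+ q.+1 * fps_deriv u) U.
Proof. by rewrite euler_y_scale coef_mx0C. Qed.

Lemma unimodular_shear_x p (A : 'M[Kxy R]_n) Ahat U
    (N := fun i => invmx U *m xcoef_mx i Ahat *m U) :
    A = Kx R ^- p *: mx_of_Cxy Ahat -> (0 < p)%N -> U \in unitmx ->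
    f *m N 0%N *m e = 0 ->
  exists2 M, Kx R ^+ p *: gauge_x (unimodular_shear U) A = mx_of_Cxy M
    & xcoef_mx 0 M = e *m N 0%N *m e + f *m N 0%N *m f + f *m N 1%N *m e.
Proof.
move=> AE p_gt0 UU fNe; pose h : Cxy R := fpsX ^+ p.
have [UUc UcV] := map_unitmx_inv (@fpsC (Cy R)) UU.
have hK : tfK h = Kx R ^+ p by apply: (rmorphXn tfK).
have h0 : tfK h != 0 by rewrite tofrac_eq0 expf_neq0 // fpsX_neq0.
pose Nh := invmx (constant_mx U) *m
  (Ahat *m constant_mx U - h *: map_mx (@euler_x R) (constant_mx U)).
have NhE : Nh = constant_mx (invmx U) *m (Ahat *m constant_mx U).
  by rewrite /Nh euler_x_constant scaler0 subr0 UcV.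
have N0 : coef_mx 0 Nh = N 0%N.
  by rewrite NhE !coef_mx0M !coef_mx0C mulmxA.
have N1 : coef_mx 1 Nh = N 1%N.
  rewrite NhE !coef_mx1M coef_mx0C !coef_mx1C coef_mx0C mul0mx addr0.
  exact: mulmx_add0A.
have [|M NDM M0] := @shear_series _ _ J Nh; first by rewrite N0.
rewrite N0 N1 in M0.
have gE := gauge_integral (@eulerK_xD R) (@eulerK_xM R) (@eulerK_x_tofrac R)
  (H := Ahat) UUc shear_mx_unit h0 NDM euler_x_shear.
(* The logarithmic derivative of the shearing is the constant [f]; it only enters
   at order [p] in [x]. *)
exists (M - h *: constant_mx f).
  by rewrite gauge_xE unimodular_shearE AE -hK; exact: gE.
by rewrite -M0 -scalerN; exact: coef_mxDXn.
Qed.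

Lemma unimodular_shear_y q (B : 'M[Kxy R]_n) Bhat U
    (d := fun u : Cy R => fpsX ^+ q.+1 * fps_deriv u) :
    B = Ky R ^- q *: mx_of_Cxy Bhat -> U \in unitmx ->
    f *m (invmx U *m (xcoef_mx 0 Bhat *m U - map_mx d U)) *m e = 0 ->
  compatible_y q B (unimodular_shear U).
Proof.
move=> BE UU fNe; pose h : Cxy R := fpsC fpsX ^+ q.
have [UUc UcV] := map_unitmx_inv (@fpsC (Cy R)) UU.
have hK : tfK h = Ky R ^+ q by apply: (rmorphXn tfK).
have h0 : tfK h != 0.
  rewrite tofrac_eq0 expf_neq0 //; apply/eqP => /fpsP/(_ 0%N)/eqP.
  by rewrite /= (negPf (fpsX_neq0 _)).
pose Nh := invmx (constant_mx U) *m
  (Bhat *m constant_mx U - h *: map_mx (@euler_y R) (constant_mx U)).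
have N0 : coef_mx 0 Nh = invmx U *m (xcoef_mx 0 Bhat *m U - map_mx d U).
  by rewrite /Nh UcV coef_mx0M coef_mx0C coef_mxD coef_mxN euler_y_constant
    coef_mx0M coef_mx0C.
have [|M NDM _] := @shear_series _ _ J Nh; first by rewrite N0.
have dD : map_mx (@euler_y R) D = D *m 0 by rewrite euler_y_shear mulmx0.
have gE := gauge_integral (@eulerK_yD R) (@eulerK_yM R) (@eulerK_y_tofrac R)
  (H := Bhat) UUc shear_mx_unit h0 NDM dD.
exists (M - h *: 0).
by rewrite gauge_yE unimodular_shearE BE -hK; exact: gE.
Qed.

End UnimodularShearing.

(** * The reduction theorem *)

Section Reduction.
Variables (R : realType) (n p q r : nat) (A B : 'M[Kxy R]_n).
Variables Ahat Bhat : 'M[Cxy R]_n.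
Hypothesis hAB : normal_crossings_system p q A B Ahat Bhat.
Hypothesis hr :
  \rank (map_mx (@FracField.tofrac (Cy R)) (xcoef_mx 0 Ahat)) = r.
Hypothesis hm : 1 < moser_rank A.

Local Notation k := {fraction Cy R}.
Local Notation tfk := (@FracField.tofrac (Cy R)).
Local Notation tfL := (@FracField.tofrac {fps k}).
Local Notation LA := (map_mx (@laurent_x R) A).
Local Notation A0 := (xcoef_mx 0 Ahat).
Local Notation A1 := (xcoef_mx 1 Ahat).

Let Kx0 : Kx R != 0.
Proof. by rewrite tofrac_eq0 fpsX_neq0. Qed.

Let A_scale : Kx R ^+ p *: A = mx_of_Cxy Ahat.
Proof. by rewrite (nc_A hAB) scalerA mulfV ?scale1r // expf_neq0. Qed.

Let LA_scale : fpsX%:F ^+ p *: LA = map_mx tfL (generic_y Ahat).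
Proof. exact: laurent_scaleKx A_scale. Qed.

Let A0_neq0 : map_mx tfk A0 != 0.
Proof.
apply: contra (nc_A0 hAB) => /eqP A00; apply/eqP; apply: tofrac_mx_inj.
by rewrite A00 map_mx0.
Qed.

Let r_bounds : (0 < r <= n)%N.
Proof. by rewrite -hr rank_leq_row lt0n mxrank_eq0 A0_neq0. Qed.

Let moser_rankA : moser_rank A = p%:R + r%:R / n%:R.
Proof.
rewrite /moser_rank (laurent_moser_rank_lead LA_scale) coef_generic_y ?hr //.
Qed.

Let p_gt0 : (0 < p)%N.
Proof.
case/andP: r_bounds => r0 le_rn; have n0 : (0 < n)%N by apply: leq_trans le_rn.
move: hm; rewrite moser_rankA; case: (p) => // hm'.
by move: hm'; rewrite add0r ltNge ler_pdivrMr ?ltr0n // mul1r ler_nat le_rn.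
Qed.

Lemma moser_reducibleP :
  moser_reducible A <-> exists2 T, T \in unitmx & reduces_rank p r A T.
Proof.
have [[T0 UT0 muE] mu_le] := moser_invariantP A.
have lt_rank T : moser_rank (gauge_x T A) < moser_rank A <-> reduces_rank p r A T.
  by rewrite moser_rankA; apply: laurent_moser_rank_lt.
split=> [red | [T UT /lt_rank]]; last by apply: le_lt_trans; apply: mu_le.
by exists T0 => //; apply/lt_rank; rewrite -muE.
Qed.

Lemma moser_thetaE : moser_theta r A0 A1 = theta r (fpsX%:F ^+ p.-1 *: LA).
Proof.
pose N := (Kx R)^-1 *: mx_of_Cy A0 + mx_of_Cy A1.
pose H := constant_mx A0 + fpsX *: constant_mx A1.
have -> : moser_theta r A0 A1 = theta r (map_mx (@laurent_x R) N).
  have at00 : @at0 k 0 = 0 by rewrite -tofrac0 at0_tofrac.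
  have xr : laurent_x (Kx R ^+ r) = fpsX%:F ^+ r.
    by rewrite rmorphXn /= laurent_Kx.
  apply: (etrans (map_poly_scaled_lambda_det (@laurent_x R) (Kx R ^+ r) N at00)).
  by rewrite /= xr.
have NH : Kx R ^+ 1 *: N = mx_of_Cxy H.
  rewrite scalerDr scalerA mulfV // scale1r.
  by apply/matrixP => i j; rewrite !mxE tofracD tofracM.
have LNH := laurent_scaleKx NH; rewrite expr1 in LNH.
have LAH : fpsX%:F *: (fpsX%:F ^+ p.-1 *: LA) = map_mx tfL (generic_y Ahat).
  by rewrite scalerA -exprS prednK.
have H0 : xcoef_mx 0 H = A0.
  apply: (etrans (coef_mxD _ _ _)).
  by rewrite coef_mx0Z scale0r addr0 coef_mx0C.
have H1 : xcoef_mx 1 H = A1.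
  by apply/matrixP => i j; rewrite !mxE fpsDE fpsXME /= add0r.
have coef0 : coef_mx 0 (generic_y H) = coef_mx 0 (generic_y Ahat).
  by rewrite !coef_generic_y H0.
have coef1 : coef_mx 1 (generic_y H) = coef_mx 1 (generic_y Ahat).
  by rewrite !coef_generic_y H1.
have := theta_congr LNH LAH coef0 coef1.
by rewrite coef0 coef_generic_y hr.
Qed.

Lemma reduces_rank_theta T : T \in unitmx -> reduces_rank p r A T ->
  moser_theta r A0 A1 = 0.
Proof.
move=> UT [/no_pole_mxP[Atil AtilE] lt_r]; rewrite moser_thetaE.
rewrite (lead_mxE AtilE) in lt_r; rewrite laurent_gauge_x in AtilE.
have [UT' _] := map_unitmx_inv (@laurent_x R) UT.
by apply: (theta_gauge_eq0 p_gt0 LA_scale _ UT' AtilE lt_r); rewrite coef_generic_y.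
Qed.

Let deflating_space : moser_theta r A0 A1 = 0 ->
  exists m (V : 'M[k]_(m, n)),
    deflating (map_mx tfk A0^T) (map_mx tfk A1^T) V
    /\ (V :&: map_mx tfk A0^T)%MS != 0.
Proof.
rewrite moser_thetaE => theta0.
pose N := fpsX%:F ^+ p.-1 *: LA.
have NT : fpsX%:F *: N^T = map_mx tfL (generic_y Ahat)^T.
  have Np : fpsX%:F *: N = fpsX%:F ^+ p *: LA by rewrite scalerA -exprS prednK.
  rewrite -map_trmx -LA_scale -Np; move: N {Np} => N.
  by apply/matrixP => i j; rewrite !mxE.
have thetaT : theta r N^T = 0 by rewrite /theta lambda_det_tr.
have c0 : coef_mx 0 (generic_y Ahat)^T = map_mx tfk A0^T.
  by rewrite coef_mx_tr coef_generic_y map_trmx.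
have c1 : coef_mx 1 (generic_y Ahat)^T = map_mx tfk A1^T.
  by rewrite coef_mx_tr coef_generic_y map_trmx.
have := theta_formula NT; rewrite c0 c1.
have -> : \rank (map_mx tfk A0^T) = r by rewrite -map_trmx mxrank_tr hr.
rewrite thetaT => /esym/eqP; rewrite mulf_eq0 polyC_eq0 mulf_eq0.
set a0 := map_mx tfk A0^T.
have := col_ebase_unit a0; rewrite unitmxE unitfE => /negPf ->.
have := row_ebase_unit a0; rewrite unitmxE unitfE => /negPf -> /= /eqP det0.
case/andP: r_bounds => _ le_rn.
apply: (deflating_of_det0 le_rn (col_ebase_unit a0) (row_ebase_unit a0) _ det0).
have ra0 : \rank a0 = r by rewrite /a0 -map_trmx mxrank_tr hr.
by rewrite -ra0 mulmx_ebase.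
Qed.

(** The pencil is used in transposed form, [theta] being the same; the rows of [Q]
    then become the columns of the unimodular factor [Q^T]. *)
Lemma reducing_transformation : moser_theta r A0 A1 = 0 ->
  exists T, [/\ T \in unitmx, reduces_rank p r A T, compatible_y q B T
              & unimodular_shearing_product T].
Proof.
move/deflating_space=> defl.
pose d (u : Cy R) : Cy R := fpsX ^+ q.+1 * fps_deriv u.
have dD : {morph d : u v / u + v}.
  by move=> u v; rewrite /d fps_derivD mulrDr.
have dM u v : d (u * v) = d u * v + u * d v.
  by rewrite /d fps_derivM mulrDr mulrA (mulrCA _ u).
have [ord0 ord1] := integrability_orders p_gt0 hAB.
set B0 := xcoef_mx 0 Bhat in ord0 ord1; set B1 := xcoef_mx 1 Bhat in ord1.
rewrite -/d in ord0 ord1.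
(* The integrability condition, transposed. *)
have comm0 : A0^T *m B0^T = map_mx d A0^T + B0^T *m A0^T.
  by rewrite -!trmx_mul ord0 linearD /= map_trmx.
have comm1 : A1^T *m B0^T + A0^T *m B1^T =
    map_mx d A1^T + B1^T *m A0^T + B0^T *m A1^T.
  by rewrite -!trmx_mul -linearD /= ord1 !linearD /= map_trmx addrA.
have [Q [J [UQ eQa0 stable lead]]] := reduction_basis dD dM comm0 comm1 defl.
set e := indicator_mx _ J in eQa0 stable lead.
set f := indicator_mx _ (predC J) in stable lead.
have eT : e^T = e by apply: tr_indicator.
have fT : f^T = f by apply: tr_indicator.
have UU : Q^T \in unitmx by rewrite unitmx_tr.
have conjT (C : 'M[Cy R]_n) : (Q *m C^T *m invmx Q)^T = invmx Q^T *m C *m Q^T.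
  by rewrite !trmx_mul trmxK trmx_inv mulmxA.
have N0e : invmx Q^T *m A0 *m Q^T *m e = 0.
  have eN0 : e *m (Q *m A0^T *m invmx Q) = 0 by rewrite !mulmxA eQa0 mul0mx.
  by have := congr1 trmx eN0; rewrite trmx_mul eT conjT trmx0.
have AE := nc_A hAB; have BE := nc_B hAB.
have fNe : f *m (invmx Q^T *m A0 *m Q^T) *m e = 0 by rewrite -mulmxA N0e mulmx0.
have [M MA M0] := unimodular_shear_x AE p_gt0 UU fNe.
exists (unimodular_shear J Q^T); split.
- exact: unimodular_shear_unit.
- have LE := laurent_scaleKx MA; split.
    by apply/no_pole_mxP; exists (generic_y M).
  rewrite (lead_mxE LE) coef_generic_y -mxrank_tr map_trmx.
  rewrite (shear_lead_tr eT fT (esym (conjT A0)) (esym (conjT A1)) N0e M0).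
  by apply: leq_trans lead _; rewrite -map_trmx mxrank_tr hr.
- apply: (unimodular_shear_y BE UU).
  apply: trmx_inj; rewrite trmx0 !trmx_mul eT fT -stable.
  rewrite linearB /= trmx_mul trmxK map_trmx trmxK trmx_inv trmxK.
  by rewrite !mulmxA.
- exact: unimodular_shearP.
Qed.

End Reduction.

Theorem theorem4 (R : realType) (n p q r : nat)
    (A B : 'M[Kxy R]_n) (Ahat Bhat : 'M[Cxy R]_n)
    (hAB : normal_crossings_system p q A B Ahat Bhat)
    (hr : \rank (map_mx (@FracField.tofrac (Cy R)) (xcoef_mx 0 Ahat)) = r)
    (hm : 1 < moser_rank A) :
  [/\ moser_reducible A <-> moser_theta r (xcoef_mx 0 Ahat) (xcoef_mx 1 Ahat) = 0,
      moser_reducible A <-> (exists2 T, T \in unitmx & reduces_rank p r A T)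
    & moser_reducible A ->
        exists T, [/\ T \in unitmx, reduces_rank p r A T, compatible_y q B T
                    & unimodular_shearing_product T]].
Proof.
have redP := moser_reducibleP hAB hr.
have thetaP : moser_reducible A ->
    moser_theta r (xcoef_mx 0 Ahat) (xcoef_mx 1 Ahat) = 0.
  by case/redP=> T UT /(reduces_rank_theta hAB hr hm UT).
have transP := @reducing_transformation _ _ _ _ _ _ _ _ _ hAB hr hm.
split=> //; last by move/thetaP/transP.
split=> // /transP[T [UT redT _ _]].
by apply/redP; exists T.
Qed.
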